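(* Let $t_0\ge 0$, $m\ge1$, let $b_1,\dots,b_m:[0,\infty)\to\mathbb{R}$ be Lebesgue measurable and essentially bounded, and let $h_1,\dots,h_m$ be Lebesgue measurable on $[0,\infty)$ with constants $0\le\delta_k\le\tau_k<\infty$ such that $\delta_k\le t-h_k(t)\le\tau_k$ for $t\ge t_0$; set $\tau=\max_k\tau_k$. Let $f:[t_0,\infty)\to\mathbb{R}$ be Lebesgue measurable and locally essentially bounded, and $\phi:[t_0-\tau,t_0]\to\mathbb{R}$ bounded and Borel measurable. Consider the problem $$\dot{x}(t)+\sum_{k=1}^m b_k(t)x(h_k(t))=f(t),\ t\ge t_0;\qquad x(t)=\phi(t),\ t\le t_0.$$ Assume there are constants $\lambda>0$ and $\alpha>0$ such that $$a(t):=\sum_{k=1}^m e^{\lambda(t-h_k(t))}b_k(t)-\lambda\ge\alpha,\quad t\ge t_0,$$ and, with $a_k(t)=e^{\lambda(t-h_k(t))}b_k(t)$, $$M_1:=\Big(\lambda+\sum_{k=1}^m e^{\lambda\tau_k}\|b_k\|_{[t_0,\infty)}\Big)\sum_{k=1}^m\tau_k\Big\|\frac{a_k}{a}\Big\|_{[t_0,\infty)}<1.$$ Then, with $M_0:=(1-M_1)^{-1}$, the solution $x$ of the problem satisfies for all $t\ge t_0$ $$|x(t)|\le M_0e^{-\lambda(t-t_0)}\Big[|x(t_0)|+\sum_{k=1}^m\frac{e^{\lambda\tau_k}-1}{\lambda}\|b_k\|_{[t_0,\infty)}\|\phi\|_{[t_0-\tau,t_0]}\Big]+\frac{M_0}{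\lambda}\|f\|_{[t_0,t]}.$$
   Context: For an interval $J$, $\|g\|_J=\operatorname{ess\,sup}_{t\in J}|g(t)|$ (for $\phi$ this is the sup norm on $[t_0-\tau,t_0]$). A solution of the problem is a locally absolutely continuous function $x$ on $[t_0,\infty)$ satisfying the differential equation almost everywhere for $t\ge t_0$ and $x(t)=\phi(t)$ for $t\le t_0$ (so values $x(h_k(t))$ with $h_k(t)<t_0$ are given by $\phi$); it exists and is unique. *)

(* Defs.v *)
From HB Require Import structures.
From mathcomp Require Import all_boot all_order all_algebra.
From mathcomp Require Import all_classical all_reals all_analysis ess_sup_inf.
Set Implicit Arguments. Unset Strict Implicit. Unset Printing Implicit Defensive.
Import Order.TTheory GRing.Theory Num.Theory.
Import numFieldNormedType.Exports.
Local Open Scope classical_set_scope.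
Local Open Scope ring_scope.

(* The measurable space of Lebesgue-measurable subsets of R
   (domain of the completed Lebesgue measure). *)
Definition lebR (R : realType) : Type :=
  ltac:(let t := type of (@completed_lebesgue_measure R) in
        match t with set ?T -> _ => exact T end).

Definition leb_measurable_on (R : realType) (D : set R) (g : R -> R) : Prop :=
  measurable_fun (D : set (lebR R)) (g : lebR R -> R).

Definition ess_norm (R : realType) (g : R -> R) (J : set R) : \bar R :=
  ess_sup (@lebesgue_measure R) (fun t => ((\1_J t : R) * `|g t|)%:E).

Definition rnorm (R : realType) (g : R -> R) (J : set R) : R :=
  fine (ess_norm g J).

Definition sup_norm (R : realType) (g : R -> R) (J : set R) : R :=
  sup [set `|g t| | t in J].

Definition abs_continuous_on (R : realType) (a b : R) (x : R -> R) : Prop :=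
  forall eps : R, 0 < eps -> exists2 del : R, 0 < del &
    forall (n : nat) (u v : nat -> R),
      (forall i, (i < n)%N -> a <= u i /\ u i <= v i /\ v i <= b) ->
      (forall i j, (i < n)%N -> (j < n)%N -> i <> j -> v i <= u j \/ v j <= u i) ->
      \sum_(i < n) (v i - u i) < del ->
      \sum_(i < n) `|x (v i) - x (u i)| < eps.

Definition loc_abs_continuous (R : realType) (t0 : R) (x : R -> R) : Prop :=
  forall T, t0 <= T -> abs_continuous_on t0 T x.

Definition is_solution (R : realType) (m : nat) (b h : 'I_m -> R -> R)
    (f phi : R -> R) (t0 tau : R) (x : R -> R) : Prop :=
  [/\ forall t, t0 - tau <= t <= t0 -> x t = phi t,
      loc_abs_continuous t0 x &
      {ae @lebesgue_measure R, forall t, t0 <= t ->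
         derivable x t 1 /\
         derive1 x t + \sum_(k < m) b k t * x (h k t) = f t}].

(* Main.v *)
(* Put y(t) = e^(lam (t - t0)) x(t) on [t0, oo) and y = 0 before t0.  Then
   y' = N y + F with N u (t) = lam u(t) - sum_k a_k(t) u(h_k(t)), where F gathers
   f and the history terms, and |F| is the derivative of an explicit V.  Let
   L = lam + sum_k A_k with |a_k| <= A_k, so that M1 = L sum_k rho_k tau_k with
   rho_k = ||a_k / a||.

   Impulse response.  Let y vanish before s and be driven by a source of total
   mass V0 supported in [s, s + eps], let Y bound |y|, and put
   sg = sum_k rho_k (tau_k + eps).  For t <= s + sg the bound
   |y(t)| <= V0 + L sg Y is immediate.  For t > s + sg write
   y' = - a y + sum_k a_k (y(t) - y(h_k(t))): the differences are at most
   L Y tau_k, plus V0 for those k whose delay reaches back to [s, s + eps]; these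
   satisfy tau_k + eps > sg, so their rho_k add up to at most 1.  Hence
   |y| <= V0 + L sg Y throughout, i.e. sup |y| <= V0 / (1 - L sg).

   Superposition.  A jump at t0 together with a spread-out F cannot be treated
   directly with this constant, so F is switched off after time s: the resulting
   continuations of y for s and s + eps differ by an impulse response of mass
   V(s + eps) - V(s).  Summing over steps and letting eps tend to 0 gives
   |y(T)| <= V(T) / (1 - M1).

   Absolute continuity enters only through one comparison principle (ac_le), and
   Lebesgue integration only through primitives of bounded measurable functions,
   from which the continuations are built by Picard iteration. *)

Require Import Defs.
From HB Require Import structures.
From mathcomp Require Import all_boot all_order all_algebra ring lra measurable_realfun.
From mathcomp Require Import all_classical all_reals all_analysis ess_sup_inf.
Set Implicit Arguments. Unset Strict Implicit. Unset Printing Implicit Defensive.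
Import Order.TTheory GRing.Theory Num.Theory.
Import numFieldNormedType.Exports.
Local Open Scope classical_set_scope.
Local Open Scope ring_scope.

#[local] Instance ae_lebesgue_filter (R : realType) :
  Filter (nbhs (almost_everywhere (@lebesgue_measure R))).
Proof. exact: ae_filter_ringOfSetsType. Qed.

(** * Comparison for absolutely continuous functions *)

(** Local input to the real induction below. Both sides of [t] are treated, because the induction
    has to arrive at a point as well as to leave it. *)
Lemma slope_of_derive_le0 (R : realType) (f : R -> R) (t e : R) :
  derivable f t 1 -> derive1 f t <= 0 -> 0 < e ->
  exists2 d, 0 < d & forall r, `|r - t| < d ->
    (t <= r -> f r - f t <= e * (r - t)) /\
    (r <= t -> f t - f r <= e * (t - r)).
Proof.
move=> df f0 e0.
have cv : h^-1 *: (f (h + t) - f t) @[h --> 0^'] --> derive1 f t.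
  have -> : derive1 f t = 'D_1 f t by rewrite derive1E.
  have := df; rewrite /derivable => /cvg_ex[l hl].
  have -> : 'D_1 f t = l by apply: cvg_lim; first exact: Rhausdorff.
  rewrite (_ : (fun h => _) = fun h : R => h^-1 *: (f (h *: 1 + t) - f t))//.
  by apply/funext => h; congr (_ *: (f (_ + _) - _)); rewrite /GRing.scale/= mulr1.
move/cvgrPdist_lt : cv => /(_ e e0).
rewrite near_withinE => -[d d0 hd]; exists d => // r rtd.
have [->|rt] := eqVneq r t; first by rewrite !subrr mulr0.
have rt0 : r - t != 0 by rewrite subr_eq0.
have := hd (r - t); rewrite /ball_ /= sub0r normrN => /(_ rtd rt0).
rewrite subrK /GRing.scale/= => hlt.
have {hlt} : (r - t)^-1 * (f r - f t) < e.
  by move: hlt; rewrite ltr_norml => /andP[h1 h2]; lra.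
set q := _ * _ => qe.
have qE : f r - f t = q * (r - t) by rewrite /q mulrAC mulVf ?mul1r.
split=> [tr|rt'].
  by rewrite qE ler_wpM2r ?subr_ge0// ltW.
have -> : f t - f r = q * (t - r) by rewrite -opprB qE; ring.
by rewrite ler_wpM2r ?subr_ge0// ltW.
Qed.

Lemma ac_continuous (R : realType) (a b : R) (u : R -> R) (e : R) :
  abs_continuous_on a b u -> 0 < e ->
  exists2 d, 0 < d & forall s t, a <= s <= b -> a <= t <= b ->
    `|s - t| < d -> `|u s - u t| < e.
Proof.
move=> acu e0; have [d d0 hd] := acu e e0; exists d => // s t.
wlog st : s t / s <= t => [hw|] sab tab std.
  case/orP: (le_total s t) => st; first exact: hw.
  by rewrite distrC; apply: hw => //; rewrite distrC.
have := hd 1%N (fun=> s) (fun=> t); rewrite !big_ord1 distrC; apply.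
- by move=> i _; case/andP: sab => -> _; case/andP: tab => _ ->.
- by move=> [|i] [|j].
- by rewrite ler0_norm ?subr_le0// opprB in std.
Qed.

Section real_induction_cover.
Context {R : realType}.
Variables (a b G e : R) (u : R -> R) (U : set R).
Hypotheses (e0 : 0 < e) (oU : open U).

(* [variation_cover t] records u t <= G + e + e (t - a) + (variation of u over
   finitely many disjoint subintervals of U `&` [a, t]).  Unlike the bound with
   the supremum of such variations, it propagates by real induction without any
   limit passage. *)
Let variation_cover (t : R) := exists n (p q : nat -> R), [/\
  forall i, (i < n)%N -> a <= p i /\ p i <= q i /\ q i <= t,
  forall i j, (i < n)%N -> (j < n)%N -> i <> j -> q i <= p j \/ q j <= p i,
  ((\sum_(i < n) (q i - p i))%:E <= lebesgue_measure (U `&` `[a, t]))%E &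
  u t <= G + e + e * (t - a) + \sum_(i < n) `|u (q i) - u (p i)|].

(** The empty family suffices. Besides starting the induction at [a], this restarts it wherever [u]
    is within [e] of [G]. *)
Let cover_start t : a <= t -> u t <= G + e -> variation_cover t.
Proof.
move=> at_ ut; exists 0%N, (fun=> 0), (fun=> 0); split => //.
  by rewrite big_ord0 measure_ge0.
by rewrite big_ord0 addr0 (le_trans ut)// lerDl mulr_ge0 ?subr_ge0// ltW.
Qed.

Let measurable_cover t : measurable (U `&` `[a, t]).
Proof. by apply: measurableI => //; exact: open_measurable. Qed.

(** The family is kept; the growth of [u] goes into the term [e * (t - a)]. *)
Let cover_slope t t' : variation_cover t -> t <= t' ->
  u t' - u t <= e * (t' - t) -> variation_cover t'.
Proof.
move=> [n [p [q [h1 h2 h3 h4]]]] tt' hu; exists n, p, q; split => //.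
- by move=> i /h1[? [? ?]]; split=> //; split=> //; apply: le_trans tt'.
- apply: le_trans h3 _; apply: le_measure; rewrite ?inE; try exact: measurable_cover.
  by move=> x [Ux]; rewrite /= !in_itv/= => /andP[h5 h6]; rewrite h5 (le_trans h6).
- set S := \sum_(i < _) _ in h4 *; lra.
Qed.

(** The interval from [t] to [t'] lies in [U] and is appended to the family, which pays for the
    growth of [u] by its variation. *)
Let cover_interval t t' : variation_cover t -> a <= t -> t <= t' ->
  `[t, t'] `<=` U -> variation_cover t'.
Proof.
move=> [n [p [q [h1 h2 h3 h4]]]] at_ tt' hU.
exists n.+1, (fun i => if (i < n)%N then p i else t),
  (fun i => if (i < n)%N then q i else t').
have nn i : (i < n.+1)%N -> ~~ (i < n)%N -> i = n.
  by rewrite ltnS -leqNgt => h1' h2'; apply/eqP; rewrite eqn_leq h1'.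
split.
- move=> i _; case: ifPn => [/h1[? [? ?]]|//].
  by split=> //; split=> //; apply: le_trans tt'.
- move=> i j ilt jlt ij.
  case: ifPn => iN; case: ifPn => jN.
  + exact: h2.
  + by left; have [_ []] := h1 _ iN.
  + by right; have [_ []] := h1 _ jN.
  + by exfalso; apply: ij; rewrite (nn i)// (nn j).
- rewrite big_ord_recr/= ltnn.
  rewrite (eq_bigr (fun i : 'I_n => q i - p i)); last by move=> i _; rewrite ltn_ord.
  rewrite EFinD.
  (* The left end is left out so that the new piece is disjoint from the part of [U] up to [t]. *)
  have -> : ((t' - t)%:E = lebesgue_measure (`]t, t'] : set R))%E.
    rewrite lebesgue_measure_itv/= lte_fin; case: ltP => // t't.
    by congr EFin; lra.
  apply: (@le_trans _ _ (lebesgue_measure ((U `&` `[a, t]) `|` `]t, t']))).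
    rewrite measureU//; [|exact: measurable_cover|]; first by rewrite leeD2r.
    rewrite -subset0 => x /= [[_]]; rewrite !in_itv/= => /andP[_ xt] /andP[tx _].
    by have := le_lt_trans xt tx; rewrite ltxx.
  apply: le_measure; rewrite ?inE; [|exact: measurable_cover|].
    by apply: measurableU; [exact: measurable_cover|exact: measurable_itv].
  move=> x [[Ux]|] /=; rewrite !in_itv/= => /andP[h5 h6]; split.
  + by [].
  + by rewrite h5 (le_trans h6).
  + by apply: hU; rewrite /= in_itv/= ltW.
  + by rewrite (le_trans at_ (ltW h5)).
- rewrite big_ord_recr/= ltnn.
  rewrite (eq_bigr (fun i : 'I_n => `|u (q i) - u (p i)|)); last first.
    by move=> i _; rewrite ltn_ord.
  set S := \sum_(i < _) _ in h4 *.
  have et : e * (t - a) <= e * (t' - a) by rewrite ler_wpM2l ?(ltW e0)// lerD2r.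
  have := ler_norm (u t' - u t); lra.
Qed.

(** Near each point the property passes in both directions: inside [U] by appending an interval,
    where [u t <= G] by restarting with the empty family, and elsewhere by the slope estimate. Hence
    it holds at the supremum of the points reached, and that supremum is [b]. *)
Lemma cover_real_induction : a <= b -> u a <= G -> U a -> U b ->
  abs_continuous_on a b u ->
  (forall t, a < t < b -> ~ U t -> G < u t ->
     derivable u t 1 /\ derive1 u t <= 0) ->
  variation_cover b.
Proof.
move=> ab ua Ua Ub acu good.
have local t : a <= t <= b -> exists2 d, 0 < d & forall r, a <= r <= b ->
    `|r - t| < d -> (r <= t -> variation_cover r -> variation_cover t) /\
                    (t <= r -> variation_cover t -> variation_cover r).
  move=> tab; have [Ut|nUt] := pselect (U t).
    have /nbhs_ballP[d /= d0 hd] := open_nbhs_nbhs (conj oU Ut).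
    exists d => // r rab rtd; split => rt Q.
      apply: (cover_interval Q) => //; first by case/andP: rab.
      move=> x /=; rewrite in_itv/= => /andP[h1 h2]; apply: hd.
      rewrite /ball/=; move: rtd; rewrite ltr_norml => /andP[h3 h4].
      by rewrite ltr_norml; apply/andP; split; lra.
    apply: (cover_interval Q) => //; first by case/andP: tab.
    move=> x /=; rewrite in_itv/= => /andP[h1 h2]; apply: hd.
    rewrite /ball/=; move: rtd; rewrite ltr_norml => /andP[h3 h4].
    by rewrite ltr_norml; apply/andP; split; lra.
  have [utG|Gut] := leP (u t) G.
    have [d d0 hd] := ac_continuous acu e0.
    exists d => // r rab rtd; have := hd r t rab tab rtd.
    rewrite ltr_norml => /andP[h1 h2].
    case/andP: (rab) => ar _; case/andP: (tab) => at_ _.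
    by split=> rt _; apply: cover_start => //; lra.
  have tab' : a < t < b.
    case/andP: tab => at_ tb; rewrite !lt_neqAle at_ tb !andbT.
    by apply/andP; split; apply/eqP => E; apply: nUt; rewrite -?E // E.
  have [du du0] := good t tab' nUt Gut.
  have [d d0 hd] := slope_of_derive_le0 du du0 e0.
  exists d => // r rab rtd; have [h1 h2] := hd r rtd.
  by split => rt Q; apply: (cover_slope Q) => //; auto.
pose S := [set t | a <= t <= b /\ variation_cover t].
have Sa : S a.
  by split; [rewrite lexx | apply: cover_start => //; rewrite ler_wpDr// ltW].
have ubS : ubound S b by move=> t [/andP[]].
have hS : has_sup S by split; [exists a | exists b].
have ac : a <= sup S by apply: ub_le_sup => //; exists b.
have cb : sup S <= b by apply: ge_sup => //; exists a.
have cab : a <= sup S <= b by rewrite ac cb.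
have [d d0 hd] := local _ cab.
(* Points of [S] close below the supremum hand the property on to it. *)
have Qc : variation_cover (sup S).
  have [r [rab Qr] rc] := sup_adherent d0 hS.
  have rc' : r <= sup S by apply: ub_le_sup => //; exists b.
  have [|h _] := hd r rab; last exact: h.
  by rewrite ltr_norml; apply/andP; split; lra.
have [cltb|] := ltP (sup S) b; last first.
  by move=> bc; have -> : b = sup S by apply/eqP; rewrite eq_le bc cb.
(* From a supremum below [b] the property would pass on to this larger point. *)
pose r := Num.min b (sup S + d / 2).
have rb : r <= b by rewrite ge_min lexx.
have rc2 : r <= sup S + d / 2 by rewrite ge_min lexx orbT.
have cr : sup S < r by rewrite lt_min cltb/=; lra.
have rab : a <= r <= b by rewrite rb andbT; lra.
have [|_ h] := hd r rab; first by rewrite ltr_norml; apply/andP; split; lra.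
have : r <= sup S by apply: ub_le_sup; [exists b|split=> //; apply: h => //; exact: ltW].
by rewrite leNgt cr.
Qed.

End real_induction_cover.

(** The exceptional null set is covered by an open set of measure below the [d] that absolute
    continuity gives for [e]. The variation of [u] over the cover is then below [e], and the total
    error is at most [e * (2 + (b - a)) = eps]. Asking for a sign of the derivative only where [u]
    exceeds [G] makes this a maximum principle. *)
Lemma ac_le (R : realType) (a b G : R) (u : R -> R) :
  a <= b -> abs_continuous_on a b u ->
  {ae @lebesgue_measure R, forall t, a < t < b -> G < u t ->
     derivable u t 1 /\ derive1 u t <= 0} ->
  u a <= G -> u b <= G.
Proof.
move=> ab acu [N [mN N0 hN]] ua; apply/ler_addgt0Pr => eps eps0.
pose e := eps / (2 + (b - a)).
have ba0 : 0 <= b - a by rewrite subr_ge0.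
have e0 : 0 < e by rewrite divr_gt0//; lra.
have [d d0 hd] := acu e e0.
(* The derivative is controlled only inside the interval, so the endpoints join the exceptional
   set. *)
pose E := N `|` [set a; b].
have mE : measurable E.
  by apply: measurableU => //; apply: measurableU; exact: measurable_set1.
have E0 : lebesgue_measure E = 0%E.
  apply: null_set_setU => //; first by apply: measurableU; exact: measurable_set1.
  apply: null_set_setU; [exact: measurable_set1|exact: measurable_set1| |];
  exact: lebesgue_measure_set1.
have Eoo : (lebesgue_measure E < +oo)%E by rewrite E0 ltry.
have [U [oU EU muU]] := lebesgue_regularity_outer mE Eoo d0.
have mU : measurable U by exact: open_measurable.
have Ud : (lebesgue_measure U < d%:E)%E.
  rewrite -(setDUK EU); apply: le_lt_trans muU.
  rewrite -[leRHS]add0e -E0 measureU2//.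
  exact: measurableD.
have good t : a < t < b -> ~ U t -> G < u t -> derivable u t 1 /\ derive1 u t <= 0.
  move=> tab nUt; apply: contrapT => hP; apply: nUt; apply: EU; left; apply: hN.
  by move=> h; apply: hP; exact: h.
have Ua : U a by apply: EU; right; left.
have Ub : U b by apply: EU; right; right.
have [n [p [q [h1 h2 h3 h4]]]] := cover_real_induction e0 oU ab ua Ua Ub acu good.
have {}h3 : \sum_(i < n) (q i - p i) < d.
  rewrite -lte_fin; apply: le_lt_trans h3 _; apply: le_lt_trans Ud.
  by apply: le_measure; rewrite ?inE; [exact: measurableI|exact: mU|exact: subIsetl].
have := hd n p q h1 h2 h3.
have : e * (2 + (b - a)) = eps by rewrite /e divfK//; lra.
set SS := \sum_(i < n) _ in h4 *; lra.
Qed.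

(** * Primitives of bounded Lebesgue measurable functions *)

Lemma leb_measurable_decomposition (R : realType) (A : set R) :
  measurable (A : set (lebR R)) ->
  exists B, [/\ measurable B, B `<=` A & (@lebesgue_measure R).-negligible (A `\` B)].
Proof.
move=> mA.
have : completed_algebra_gen (@lebesgue_measure R) A.
  by rewrite -g_sigma_completed_algebra_genE completed_caratheodory_measurable.
move=> [B mB [N nN BN]]; exists B; split => //.
  by rewrite -BN; exact: subsetUl.
by apply: negligibleS nN; rewrite -BN => x [[]].
Qed.

Lemma borel_leb_measurable (R : realType) (A : set R) :
  measurable A -> measurable (A : set (lebR R)).
Proof. by move=> mA; exact: sub_caratheodory. Qed.

(** Each rational sublevel set of [g] is replaced by a Borel subset with negligible difference, and
    [g'] is rebuilt as the infimum of the rationals whose set contains [t]. Keeping only rationals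
    above [- C] and adding [C] itself confines [g'] to the range from [- C] to [C]. Countably many
    negligible differences remain negligible. *)
Lemma borel_version (R : realType) (D : set R) (g : R -> R) (C : R) :
  measurable D -> 0 <= C -> leb_measurable_on D g ->
  exists g' : R -> R, [/\ measurable_fun setT g', forall t, `|g' t| <= C &
    {ae @lebesgue_measure R, forall t, D t -> `|g t| <= C -> g' t = g t}].
Proof.
move=> mD C0 mg.
(* Codes of no rational are sent to 0, which only repeats a value. *)
pose q n : R := ratr (odflt 0%Q (unpickle n)).
pose A n := D `&` g @^-1` `]-oo, q n[.
have mA n : measurable (A n : set (lebR R)).
  by apply: mg; [exact: borel_leb_measurable|exact: measurable_itv].
pose B n := projT1 (cid (leb_measurable_decomposition (mA n))).
have HB n : [/\ measurable (B n), B n `<=` A n &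
    (@lebesgue_measure R).-negligible (A n `\` B n)].
  by rewrite /B; case: cid.
pose S t := [set r | r = C \/ exists2 n, r = q n & - C <= q n /\ B n t].
have SC t : S t C by left.
have lbS t : lbound (S t) (- C).
  by move=> r [->|[n -> []]//]; rewrite ge0_cp// oppr_le0.
pose g' t := inf (S t).
have hlb t : has_lbound (S t) by exists (- C).
have hinf t : has_inf (S t) by split => //; exists C.
have g'lt t r : g' t < r <-> C < r \/ exists2 n, q n < r & - C <= q n /\ B n t.
  split=> [|[Cr|[n nr Bn]]].
  - move/inf_lt => -[|z [->|[n -> Bn]] zr]; [by exists C|by left|].
    by right; exists n.
  - by apply: le_lt_trans Cr; apply: ge_inf.
  - by apply: le_lt_trans nr; apply: ge_inf => //; right; exists n.
exists g'; split.
- apply: (measurability _ (RGenInftyO.measurableE R)) => //.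
  move=> _ [_ [r ->] <-]; rewrite setTI.
  have -> : g' @^-1` `]-oo, r[ = (if C < r then setT else set0) `|`
      \bigcup_n (if (q n < r) && (- C <= q n) then B n else set0).
    apply/seteqP; split => t; rewrite /= in_itv/=.
      move/g'lt => [->|[n qr [Cq Bn]]]; [by left|right].
      by exists n => //; rewrite qr Cq.
    move=> H; apply/g'lt; case: H => [|[n _]].
      by case: ifP => // Cr _; left.
    by case: ifP => // /andP[? ?] ?; right; exists n.
  apply: measurableU; first by case: ifP.
  by apply: bigcupT_measurable => n; case: ifP => // _; have [] := HB n.
- move=> t; rewrite ler_norml; apply/andP; split.
    by apply: lb_le_inf => //; exists C.
  by apply: ge_inf.
- have neg : (@lebesgue_measure R).-negligible (\bigcup_n (A n `\` B n)).
    by apply: negligible_bigcup => n; have [] := HB n.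
  apply: negligibleS neg => t /= H; apply: contrapT => nAB; apply: H => Dt gC.
  have AB n : g t < q n -> B n t.
    move=> gq; apply: contrapT => nB; apply: nAB; by exists n.
  move: gC; rewrite ler_norml => /andP[gC1 gC2].
  apply/eqP; rewrite eq_le; apply/andP; split.
    rewrite leNgt; apply/negP => lt.
    have [c] := rat_in_itvoo lt; rewrite in_itv/= => /andP[c1 c2].
    suff : g' t < ratr c by rewrite ltNge (ltW c2).
    (* A second rational below [c] is taken because [g'lt] asks for a strict inequality. *)
    have [c' ] := rat_in_itvoo c1; rewrite in_itv/= => /andP[c3 c4].
    apply/g'lt; right; exists (pickle c').
      by rewrite /q pickleK.
    have qc : q (pickle c') = ratr c' by rewrite /q pickleK.
    rewrite qc; split; first by lra.
    by apply: AB; rewrite qc.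
  rewrite leNgt; apply/negP => /g'lt[|[n qn [_ Bn]]]; first by rewrite ltNge gC2.
  have [_ BA _] := HB n; have [_] := BA _ Bn; rewrite /= in_itv/= => h.
  by have := lt_trans h qn; rewrite ltxx.
Qed.

(** [F] integrates a Borel version of [g] that is bounded by [|C|] everywhere, whence the Lipschitz
    bound on the whole line; almost every derivative comes from Lebesgue differentiation. *)
Lemma primitive_exists (R : realType) (s T C : R) (g : R -> R) :
  leb_measurable_on `[s, T] g ->
  {ae @lebesgue_measure R, forall t, s < t < T -> `|g t| <= C} ->
  exists F : R -> R, [/\ forall t, t <= s -> F t = 0,
    forall p r, p <= r -> `|F r - F p| <= `|C| * (r - p) &
    {ae @lebesgue_measure R, forall t, s < t < T ->
       derivable F t 1 /\ derive1 F t = g t}].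
Proof.
move=> mg gC.
have [g' [mg' g'C gg']] := borel_version (@measurable_itv _ _) (normr_ge0 C) mg.
have bnd A : [bounded g' x | x in A].
  exists `|C|; split; first exact: num_real.
  by move=> M /ltW CM x _; exact: le_trans CM.
have mgA A : measurable_fun A g' by apply: measurable_funS mg'.
have intb (p r : itv_bound R) : (lebesgue_measure [set` Interval p r] < +oo)%E ->
    lebesgue_measure.-integrable [set` Interval p r] (EFin \o g').
  by move=> h; exact: (measurable_bounded_integrable _ h (mgA _) (bnd _)).
have inty p b1 b2 r : lebesgue_measure.-integrable [set` Interval (BSide b1 p) (BSide b2 r)]
    (EFin \o g').
  by apply: intb; rewrite lebesgue_measure_itv/=; case: ifP => // _; rewrite -EFinB ltry.
have locg : locally_integrable [set: R] g'.
  split => //; first exact: openT.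
  move=> K _ cK.
  have mK : measurable K by apply: closed_measurable; apply: compact_closed.
  have Koo := compact_finite_measure cK.
  have /integrableP[_] :=
    @measurable_bounded_integrable _ _ _ lebesgue_measure g' K mK Koo (mgA K) (bnd K).
  by [].
pose F t := (\int[lebesgue_measure]_(x in `[s, t]) g' x)%R.
have F1 := @FTC1 R g' (BLeft s) (fun y => inty s true false y) locg.
have F0 t : t <= s -> F t = 0.
  rewrite le_eqVlt => /predU1P[->|ts].
    by rewrite /F set_itv1 Rintegral_set1.
  by rewrite /F set_itv_ge ?Rintegral_set0// -leNgt bnd_simp.
have Fl p r : s <= p -> p <= r -> `|F r - F p| <= `|C| * (r - p).
  move=> sp pr; rewrite /F (Rintegral_itvB (inty s true false r))//.
  apply: le_trans (le_normr_Rintegral _ (inty p false false r)) _ => //.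
  have mpr : lebesgue_measure (`]p, r] : set R) = (r - p)%:E.
    by rewrite lebesgue_measure_itv/= lte_fin; case: ltP => // rp; congr EFin; lra.
  have -> : `|C| * (r - p) = \int[lebesgue_measure]_(x in `]p, r]) `|C|.
    rewrite Rintegral_cst//; congr (_ * _); exact: (esym (congr1 fine mpr)).
  have mproo : (lebesgue_measure (`]p, r] : set R) < +oo)%E by rewrite mpr ltry.
  apply: le_Rintegral.
  - by [].
  - exact: integrable_norm (inty p false false r).
  - apply: (@measurable_bounded_integrable _ _ _ lebesgue_measure _ _ _ mproo) => //.
    exists `|C|; split; first exact: num_real.
    by move=> M /ltW CM x _; rewrite /= normr_id.
  - by move=> x _; exact: g'C.

exists F; split => //.
  move=> p r pr; have [ps|sp] := leP p s; last by apply: Fl => //; exact: ltW.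
  rewrite (F0 _ ps) subr0; have [rs|sr] := leP r s.
    by rewrite (F0 _ rs) normr0 mulr_ge0// subr_ge0.
  rewrite -[F r]subr0 -(F0 s (lexx s)); apply: le_trans (Fl _ _ (lexx s) (ltW sr)) _.
  by rewrite ler_wpM2l// lerD2l lerN2.
apply: filterS3 F1 gC gg' => t h1 h2 h3 stT.
have [st tT] := andP stT.
have [dF ->] : derivable F t 1 /\ derive1 F t = g' t.
  by apply: h1; exact: st.
split => //; apply: h3; first by rewrite /= in_itv/= !ltW.
by apply: le_trans (ler_norm C); exact: h2.
Qed.

(** * Lipschitz functions on an interval *)

Lemma is_derive1P (R : realType) (f : R -> R) (t d : R) :
  is_derive t 1 f d <-> derivable f t 1 /\ derive1 f t = d.
Proof.
split=> [H|[df <-]]; last by rewrite derive1E; apply: DeriveDef.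
by split; [exact: ex_derive | rewrite derive1E derive_val].
Qed.

Lemma is_derive_eq_itvoo (R : realType) (f g : R -> R) (p q t d : R) :
  p < t < q -> (forall r, p < r < q -> f r = g r) ->
  is_derive t 1 f d -> is_derive t 1 g d.
Proof.
move=> ptq fg; have tI : t \in `]p, q[ by rewrite in_itv.
apply: near_eq_is_derive; apply: filterS (near_in_itvoo tI) => r.
by rewrite in_itv/=; exact: fg.
Qed.

Definition lipschitz_itv (R : realType) (a b : R) (u : R -> R) :=
  exists K, forall s t, a <= s -> s <= t -> t <= b -> `|u t - u s| <= K * (t - s).

Lemma lipschitz_itv_pos (R : realType) (a b : R) (u : R -> R) :
  lipschitz_itv a b u -> exists2 K, 0 < K &
    forall s t, a <= s -> s <= t -> t <= b -> `|u t - u s| <= K * (t - s).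
Proof.
move=> [K hK]; exists (`|K| + 1); first by rewrite ltr_wpDl.
move=> s t as_ st tb; apply: le_trans (hK _ _ as_ st tb) _.
by rewrite ler_wpM2r ?subr_ge0// (le_trans (ler_norm K))// lerDl.
Qed.

Lemma lipschitz_itvS (R : realType) (a b c d : R) (u : R -> R) :
  a <= c -> d <= b -> lipschitz_itv a b u -> lipschitz_itv c d u.
Proof.
move=> ac db [K hK]; exists K => s t cs st td.
by apply: hK => //; [exact: le_trans cs|exact: le_trans db].
Qed.

Lemma lipschitz_itvB (R : realType) (a b : R) (u v : R -> R) :
  lipschitz_itv a b u -> lipschitz_itv a b v -> lipschitz_itv a b (u - v).
Proof.
move=> [K hK] [L hL]; exists (K + L) => s t as_ st tb.
rewrite (_ : (u - v) t - (u - v) s = (u t - u s) - (v t - v s)); last first.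
  by rewrite -[(u - v) t]/(u t - v t) -[(u - v) s]/(u s - v s); ring.
by rewrite mulrDl (le_trans (ler_normB _ _))// lerD ?hK ?hL.
Qed.

Lemma lipschitz_itv_bounded (R : realType) (a b : R) (u : R -> R) :
  lipschitz_itv a b u -> exists2 M, 0 <= M & forall t, a <= t <= b -> `|u t| <= M.
Proof.
move=> /lipschitz_itv_pos[K K0 hK]; exists (`|u a| + `|K * (b - a)|) => //.
move=> t /andP[at_ tb]; have := hK a t (lexx a) at_ tb.
have : K * (t - a) <= K * (b - a) by rewrite ler_wpM2l ?(ltW K0)// lerD2r.
have := ler_norm (K * (b - a)); have := lerB_dist (u t) (u a); lra.
Qed.

Lemma lipschitz_ac (R : realType) (a b : R) (u : R -> R) :
  lipschitz_itv a b u -> abs_continuous_on a b u.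
Proof.
move=> /lipschitz_itv_pos[K K0 hK] e e0; exists (e / K); first by rewrite divr_gt0.
move=> n p q hpq _ hs; apply: (@le_lt_trans _ _ (K * \sum_(i < n) (q i - p i))).
  rewrite mulr_sumr; apply: ler_sum => i _.
  by have [h1 [h2 h3]] := hpq i (ltn_ord i); exact: hK.
by rewrite mulrC -ltr_pdivlMr.
Qed.

Lemma acS (R : realType) (a b c d : R) (u : R -> R) :
  a <= c -> d <= b -> abs_continuous_on a b u -> abs_continuous_on c d u.
Proof.
move=> ac db acu e e0; have [l l0 hl] := acu e e0; exists l => // n p q h1.
apply: hl => i /h1[h2 [h3 h4]]; split; first exact: le_trans h2.
by split => //; exact: le_trans db.
Qed.

Lemma acN (R : realType) (a b : R) (u : R -> R) :
  abs_continuous_on a b u -> abs_continuous_on a b (- u).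
Proof.
move=> acu e e0; have [l l0 hl] := acu e e0; exists l => // n p q h1 h2 h3.
apply: le_lt_trans (hl n p q h1 h2 h3); apply: ler_sum => i _.
by rewrite -[(- u) _]/(- u _) -[(- u) (p i)]/(- u _) -opprD normrN.
Qed.

Lemma acB_lipschitz (R : realType) (a b : R) (u v : R -> R) :
  abs_continuous_on a b u -> lipschitz_itv a b v -> abs_continuous_on a b (u - v).
Proof.
move=> acu /lipschitz_ac acv e e0; have e20 : 0 < e / 2 by rewrite divr_gt0.
have [d d0 hd] := acu _ e20; have [l l0 hl] := acv _ e20.
exists (Num.min d l); first by rewrite lt_min d0.
move=> n p q h1 h2; rewrite lt_min => /andP[h3 h4].
rewrite [e]splitr; apply: le_lt_trans (ltrD (hd n p q h1 h2 h3) (hl n p q h1 h2 h4)).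
rewrite -big_split/=; apply: ler_sum => i _.
rewrite (_ : (u - v) (q i) - (u - v) (p i) = (u (q i) - u (p i)) - (v (q i) - v (p i))).
  exact: ler_normB.
by rewrite -[(u - v) (q i)]/(u _ - v _) -[(u - v) (p i)]/(u _ - v _); ring.
Qed.

Lemma ac_slope (R : realType) (a b : R) (u v : R -> R) :
  a <= b -> abs_continuous_on a b u -> lipschitz_itv a b v ->
  {ae @lebesgue_measure R, forall t, a < t < b -> exists d e,
     [/\ is_derive t 1 u d, is_derive t 1 v e & d <= e]} ->
  u b - u a <= v b - v a.
Proof.
move=> ab acu lv h; suff : (u - v) b <= u a - v a.
  by rewrite -[(u - v) b]/(u b - v b); lra.
apply: (ac_le ab (acB_lipschitz acu lv)); last by [].
apply: filterS h => t h /h[d [e [du dv de]]] _.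
have /is_derive1P[? ->] := is_deriveB du dv.
by split => //; rewrite subr_le0.
Qed.

Lemma ac_dominated (R : realType) (a b : R) (u v : R -> R) :
  a <= b -> abs_continuous_on a b u -> lipschitz_itv a b v ->
  {ae @lebesgue_measure R, forall t, a < t < b -> exists d e,
     [/\ is_derive t 1 u d, is_derive t 1 v e & `|d| <= e]} ->
  `|u b - u a| <= v b - v a.
Proof.
move=> ab acu lv h; rewrite ler_norml; apply/andP; split.
  rewrite lerNl opprB.
  have -> : u a - u b = (- u) b - (- u) a.
    by rewrite -[(- u) b]/(- u b) -[(- u) a]/(- u a); ring.
  apply: ac_slope => //; first exact: acN.
  apply: filterS h => t h /h[d [e [du dv de]]]; exists (- d), e.
  by split; [exact: is_deriveN|by []|rewrite (le_trans _ de)// -normrN ler_norm].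
apply: ac_slope => //; apply: filterS h => t h /h[d [e [du dv de]]].
by exists d, e; split => //; rewrite (le_trans _ de)// ler_norm.
Qed.

Lemma lipschitz_itv_linear (R : realType) (a b c : R) : lipschitz_itv a b ( *%R c).
Proof.
by exists `|c| => s t _ st _; rewrite -mulrBr normrM (ger0_norm (_ : 0 <= t - s)) ?subr_ge0.
Qed.

Lemma is_derive_linear (R : realType) (c t : R) : is_derive t 1 ( *%R c) c.
Proof.
have H : is_derive t 1 (c \*: (@id R)) (c *: 1) by apply: is_deriveZ.
by move: H; rewrite /GRing.scale/= mulr1.
Qed.

Lemma ac_lipschitz_bound (R : realType) (a b C : R) (u : R -> R) :
  a <= b -> abs_continuous_on a b u ->
  {ae @lebesgue_measure R, forall t, a < t < b ->
    exists2 d, is_derive t 1 u d & `|d| <= C} ->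
  forall s t, a <= s -> s <= t -> t <= b -> `|u t - u s| <= C * (t - s).
Proof.
move=> ab acu h s t as_ st tb; rewrite mulrBr.
apply: ac_dominated => //; [exact: acS acu|exact: lipschitz_itv_linear|].
apply: filterS h => r h /andP[sr rt].
have [|d dr dC] := h; first by rewrite (le_lt_trans as_)//= (lt_le_trans rt).
by exists d, C; split => //; exact: is_derive_linear.
Qed.

(** The interval is crossed in steps of length at most [d / 2], over each of which [u] changes by
    less than 1. *)
Lemma ac_bounded (R : realType) (a b : R) (u : R -> R) : a <= b ->
  abs_continuous_on a b u -> exists2 M, 0 <= M & forall t, a <= t <= b -> `|u t| <= M.
Proof.
move=> ab acu; have [d d0 hd] := ac_continuous acu (@ltr01 R).
have H n t : a <= t <= b -> t - a <= n%:R * (d / 2) -> `|u t - u a| <= n%:R.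
  elim: n t => [|n IH] t /andP[at_ tb].
    rewrite mul0r subr_le0 => ta; have -> : t = a by apply/eqP; rewrite eq_le ta.
    by rewrite subrr normr0.
  rewrite -natr1 mulrDl mul1r => tn.
  pose s := Num.max a (t - d / 2).
  have as_ : a <= s by rewrite le_max lexx.
  have st : s <= t by rewrite ge_max at_/= gerBl; lra.
  have ts : t - s <= d / 2 by rewrite lerBlDl -lerBlDr le_max lexx orbT.
  have sn : s - a <= n%:R * (d / 2).
    rewrite lerBlDl ge_max lerDl mulr_ge0//=; lra.
  have sab : a <= s <= b by rewrite as_ (le_trans st).
  have tab : a <= t <= b by rewrite at_ tb.
  have h1 := IH s sab sn; have h2 : `|u t - u s| < 1.
    by apply: hd => //; rewrite ger0_norm ?subr_ge0//; lra.
  by have := ler_normD (u t - u s) (u s - u a); rewrite addrA subrK; lra.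
pose n := Num.bound `|(b - a) / (d / 2)|.
exists (`|u a| + n%:R) => // t tab.
have tn : t - a <= n%:R * (d / 2).
  rewrite -ler_pdivrMr; last lra.
  apply: (@le_trans _ _ ((b - a) / (d / 2))).
    by rewrite ler_pM2r ?invr_gt0; [rewrite lerD2r; case/andP: tab|lra].
  by apply: le_trans (ler_norm _) _; apply: ltW; exact: archi_boundP.
have := H n t tab tn; have := ler_normD (u t - u a) (u a); rewrite subrK; lra.
Qed.

Lemma lipschitz_itvM (R : realType) (a b : R) (u v : R -> R) :
  lipschitz_itv a b u -> lipschitz_itv a b v -> lipschitz_itv a b (fun t => u t * v t).
Proof.
move=> lu lv; have [M M0 hM] := lipschitz_itv_bounded lu.
have [N N0 hN] := lipschitz_itv_bounded lv.
have [[K hK] [L hL]] := (lu, lv); exists (K * N + M * L) => s t as_ st tb.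
have sab : a <= s <= b by rewrite as_ (le_trans st).
have tab : a <= t <= b by rewrite tb (le_trans as_).
rewrite (_ : _ - _ = (u t - u s) * v s + u t * (v t - v s)); last by ring.
rewrite (le_trans (ler_normD _ _))// !normrM.
have h1 : `|u t - u s| * `|v s| <= K * (t - s) * N by rewrite ler_pM// ?hK ?hN.
have h2 : `|u t| * `|v t - v s| <= M * (L * (t - s)) by rewrite ler_pM// ?hL ?hM.
by apply: le_trans (lerD h1 h2) _; rewrite le_eqVlt; apply/orP; left; apply/eqP; ring.
Qed.

Lemma lipschitz_itv_sum (R : realType) (a b : R) (m : nat) (u : 'I_m -> R -> R) :
  (forall k, lipschitz_itv a b (u k)) -> lipschitz_itv a b (fun t => \sum_(k < m) u k t).
Proof.
move=> /choice[K hK]; exists (\sum_(k < m) K k) => s t as_ st tb.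
rewrite -sumrB mulr_suml (le_trans (ler_norm_sum _ _ _))//.
by apply: ler_sum => k _; exact: hK.
Qed.

(** * Source-free continuation of a delay equation *)

Lemma borel_leb_measurable_fun (R : realType) (D : set R) (f : R -> R) :
  measurable_fun D f -> measurable D -> leb_measurable_on D f.
Proof.
move=> mf mD _ Y mY; apply: borel_leb_measurable; exact: mf.
Qed.

Lemma leb_measurable_comp (R : realType) (D : set R) (f g : R -> R) :
  measurable_fun setT f -> leb_measurable_on D g -> leb_measurable_on D (f \o g).
Proof. by move=> mf mg; apply: measurableT_comp mf mg. Qed.

Lemma lipschitz_continuous (R : realType) (K : R) (u : R -> R) :
  0 < K -> (forall s t, s <= t -> `|u t - u s| <= K * (t - s)) -> continuous u.
Proof.
move=> K0 hu t; apply/cvgrPdist_le => e e0; near=> r.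
apply: (@le_trans _ _ (K * `|t - r|)).
  have [rt|/ltW tr] := leP r t; first by rewrite (ger0_norm (_ : 0 <= t - r)) ?subr_ge0// hu.
  by rewrite distrC (distrC t) (ger0_norm (_ : 0 <= r - t)) ?subr_ge0// hu.
rewrite -ler_pdivlMl//; near: r.
have e0' : 0 < K^-1 * e by rewrite mulr_gt0// invr_gt0.
by have /cvgrPdist_le/(_ _ e0') := @cvg_id _ (nbhs t).
Unshelve. all: by end_near. Qed.

Definition zero_before (R : realType) (t0 : R) (u : R -> R) := forall t, t < t0 -> u t = 0.

(** Composition with a Lebesgue measurable delay requires a Borel outer function. Clamping the
    argument to the interval gives a continuous function, and cutting it to 0 before [a] restores
    the jump that [u] may have there. *)
Lemma lipschitz_patch_measurable (R : realType) (a b : R) (u : R -> R) :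
  a <= b -> lipschitz_itv a b u -> zero_before a u ->
  exists2 v : R -> R, measurable_fun setT v & forall t, t <= b -> v t = u t.
Proof.
move=> ab /lipschitz_itv_pos[K K0 hK] u0.
pose c t := Num.max a (Num.min t b).
have ca t : a <= c t by rewrite le_max lexx.
have cb t : c t <= b by rewrite ge_max ab ge_min lexx orbT.
have hc : continuous (u \o c).
  apply: (@lipschitz_continuous _ K) => // s t st /=.
  have cst : c s <= c t.
    by rewrite /c; apply: le_max2 => //; exact: le_min2.
  apply: le_trans (hK _ _ (ca s) cst (cb t)) _; rewrite ler_pM2l//.
  rewrite /c !maxEle !minEle.
  by do !case: ifPn; rewrite -?ltNge => *; lra.
exists (fun t => if t < a then 0 else u (c t)).
  apply: measurable_fun_ifT => //.
    exact: measurable_fun_ltr.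
  exact: continuous_measurable_fun.
move=> t tb; case: ifPn => [/u0//|]; rewrite -leNgt => at_.
by rewrite /c (min_idPl tb) (max_idPr at_).
Qed.

(** Passage to the limit in elementary form, from [n < 2 ^ n] and the archimedean property. *)
Lemma le_of_geometric (R : realType) (x z c : R) :
  (forall n, x <= z + c * 2^-1 ^+ n) -> x <= z.
Proof.
move=> H; rewrite leNgt; apply/negP => zx.
have xz0 : 0 < x - z by rewrite subr_gt0.
pose n := Num.bound `|c / (x - z)|.
have cn : c / (x - z) < n%:R.
  by apply: le_lt_trans (ler_norm _) _; exact: archi_boundP.
have c2 : c < 2 ^+ n * (x - z).
  rewrite -ltr_pdivrMr//; apply: lt_trans cn _.
  by rewrite -natrX ltr_nat ltn_expl.
have := H n; rewrite exprVn.
have p0 : 0 < (2 : R) ^+ n by rewrite exprn_gt0.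
have : c / 2 ^+ n < x - z by rewrite ltr_pdivrMr// mulrC.
lra.
Qed.

(** The intervals around [r n] of radius [2 * c * 2^-1 ^+ n] are nested; the limit is the supremum
    of their left ends. *)
Lemma geometric_limit (R : realType) (r : nat -> R) (c : R) : 0 <= c ->
  (forall n, `|r n.+1 - r n| <= c * 2^-1 ^+ n) ->
  exists l, forall n, `|l - r n| <= 2 * c * 2^-1 ^+ n.
Proof.
move=> c0 H.
pose v n := r n - 2 * c * 2^-1 ^+ n; pose w n := r n + 2 * c * 2^-1 ^+ n.
have q0 n : 0 <= c * 2^-1 ^+ n by rewrite mulr_ge0// exprn_ge0.
have qS n : c * 2^-1 ^+ n.+1 = (c * 2^-1 ^+ n) / 2 by rewrite exprS; field.
have nv : nondecreasing_seq v.
  apply/nondecreasing_seqP => n; rewrite /v -!mulrA qS.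
  by have := H n; rewrite ler_norml => /andP[h1 h2]; lra.
have nw : nonincreasing_seq w.
  apply/nonincreasing_seqP => n; rewrite /w -!mulrA qS.
  by have := H n; rewrite ler_norml => /andP[h1 h2]; lra.
have vw n p : v n <= w p.
  apply: (@le_trans _ _ (v (maxn n p))); first by apply: nv; exact: leq_maxl.
  apply: (@le_trans _ _ (w (maxn n p))); last by apply: nw; exact: leq_maxr.
  by rewrite /v /w -!mulrA; have := q0 (maxn n p); lra.
exists (sup (range v)) => n.
have h1 : v n <= sup (range v).
  by apply: ub_le_sup; [exists (w n) => _ [p _ <-]|exists n].
have h2 : sup (range v) <= w n.
  by apply: ge_sup => [|_ [p _ <-]//]; exists (v 0%N), 0%N.
by rewrite ler_norml; move: h1 h2; rewrite /v /w => h1 h2; apply/andP; split; lra.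
Qed.

Lemma is_derive_scaled_exp (R : realType) (c l s t : R) :
  is_derive t 1 (fun r => c * expR (l * (r - s))) (c * l * expR (l * (t - s))).
Proof.
have H1 : is_derive t 1 (fun r : R => r - s) 1.
  rewrite -[X in is_derive _ _ _ X]subr0.
  exact: (@is_deriveB _ _ _ id (cst s)).
have H2 : is_derive t 1 (fun r : R => l * (r - s)) l.
  have H : is_derive t 1 (l \*: (fun r : R => r - s)) (l *: 1) by apply: is_deriveZ.
  by move: H; rewrite /GRing.scale/= mulr1.
have H3 := @is_derive1_comp R expR _ t _ _ (is_derive_expR _) H2.
have H : is_derive t 1 (c \*: (expR \o (fun r : R => l * (r - s))))
    (c *: (expR (l * (t - s)) * l)) by apply: is_deriveZ.
by rewrite (_ : c * l * _ = c *: (expR (l * (t - s)) * l))// /GRing.scale/=; ring.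
Qed.

(** The increment of the exponential is its larger value times one minus a ratio, and
    [1 + z <= expR z] bounds that factor linearly. *)
Lemma lipschitz_scaled_exp (R : realType) (c l s p q : R) : 0 <= l ->
  lipschitz_itv p q (fun r => c * expR (l * (r - s))).
Proof.
move=> l0; exists (`|c| * (l * expR (l * (q - s)))) => x y px xy yq.
rewrite -mulrBr normrM -mulrA ler_wpM2l//.
have lxy : l * (x - s) <= l * (y - s) by rewrite ler_wpM2l// lerD2r.
have lyq : l * (y - s) <= l * (q - s) by rewrite ler_wpM2l// lerD2r.
rewrite ger0_norm; last by rewrite subr_ge0 ler_expR.
have E : expR (l * (x - s)) = expR (l * (y - s)) * expR (l * (x - s) - l * (y - s)).
  by rewrite -expRD; congr expR; ring.
rewrite E -{1}[expR (l * (y - s))]mulr1 -mulrBr.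
have := expR_ge1Dx (l * (x - s) - l * (y - s)).
set X := expR _ => hX; have hX' : 1 - X <= l * (y - x) by lra.
rewrite (mulrC l (expR _)) -mulrA; apply: (@le_trans _ _ (expR (l * (y - s)) * (l * (y - x)))).
  by rewrite ler_wpM2l ?expR_ge0.
by rewrite ler_wpM2r ?ler_expR// mulr_ge0// subr_ge0.
Qed.

Section delay_operator.
Context {R : realType} {m : nat}.
Variables (a h : 'I_m -> R -> R) (lam : R).

Definition delay_rhs (u : R -> R) (t : R) :=
  lam * u t - \sum_(k < m) a k t * u (h k t).

Lemma delay_rhsB u v t : delay_rhs (u - v) t = delay_rhs u t - delay_rhs v t.
Proof.
rewrite /delay_rhs -[(u - v) t]/(u t - v t).
under eq_bigr do rewrite -[(u - v) _]/(u _ - v _) mulrBr.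
by rewrite sumrB; ring.
Qed.

Variables (t0 T : R) (A : 'I_m -> R).
Hypotheses (lam0 : 0 <= lam) (t0T : t0 <= T).
Hypothesis A0 : forall k, 0 <= A k.
Hypothesis ht : forall k t, t0 <= t -> h k t <= t.
Hypothesis aA : {ae @lebesgue_measure R, forall t, t0 < t -> forall k, `|a k t| <= A k}.
Hypothesis ma : forall k, leb_measurable_on `[t0, +oo[ (a k).
Hypothesis mh : forall k, leb_measurable_on `[t0, +oo[ (h k).

Let L := lam + \sum_(k < m) A k.

Lemma delay_rhs_bound u M t : t0 <= t -> (forall k, `|a k t| <= A k) ->
  (forall r, r <= t -> `|u r| <= M) -> `|delay_rhs u t| <= L * M.
Proof.
move=> t0t aAt uM; rewrite /delay_rhs mulrDl (le_trans (ler_normB _ _))//.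
apply: lerD; first by rewrite normrM (ger0_norm lam0) ler_wpM2l// uM.
rewrite mulr_suml (le_trans (ler_norm_sum _ _ _))//; apply: ler_sum => k _.
by rewrite normrM ler_pM// uM// ht.
Qed.

Lemma delay_rhs_measurable u s : t0 <= s -> zero_before t0 u -> lipschitz_itv t0 T u ->
  leb_measurable_on `[s, T] (delay_rhs u).
Proof.
move=> t0s u0 lu; have [v mv vu] := lipschitz_patch_measurable t0T lu u0.
have sub : `[s, T] `<=` `[t0, +oo[.
  by move=> t /=; rewrite !in_itv/= andbT => /andP[st _]; exact: le_trans st.
have mI : measurable (`[t0, +oo[ : set (lebR R)) by exact: borel_leb_measurable.
have mS g : leb_measurable_on `[t0, +oo[ g -> leb_measurable_on `[s, T] g.
  by move=> mg; apply: measurable_funS mg.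
have : leb_measurable_on `[s, T] (fun t => lam * v t - \sum_(k < m) a k t * v (h k t)).
  apply: measurable_funB.
    apply: measurable_funM => //.
    by apply: borel_leb_measurable_fun => //; exact: measurable_funTS.
  apply: measurable_sum => k; apply: measurable_funM; first exact: mS.
  by apply: leb_measurable_comp => //; exact: mS.
apply: eq_measurable_fun => t; rewrite inE /= in_itv/= => /andP[st tT].
rewrite /delay_rhs vu//; congr (_ - _); apply: eq_bigr => k _.
by rewrite vu// (le_trans (ht _ _))// (le_trans t0s).
Qed.


(** * Picard iteration for the continuation after time [s] *)

Variables (y : R -> R) (s : R).
Hypotheses (t0s : t0 <= s) (sT : s <= T).
Hypotheses (y0 : zero_before t0 y) (ly : lipschitz_itv t0 T y).

Let adm u := zero_before t0 u /\ lipschitz_itv t0 T u.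

Let adm_bounded u : adm u -> exists2 M, 0 <= M & forall t, t <= T -> `|u t| <= M.
Proof.
move=> [u0 /lipschitz_itv_bounded[M M0 hM]]; exists M => // t tT.
have [/u0->|t0t] := ltP t t0; first by rewrite normr0.
by apply: hM; rewrite t0t.
Qed.

(** Stated for every [u], with an arbitrary value outside the admissible functions, so that choice
    yields a total operator. *)
Let primitive_ex u : exists F, adm u -> [/\ forall t, t <= s -> F t = 0,
  lipschitz_itv s T F &
  {ae @lebesgue_measure R, forall t, s < t < T -> is_derive t 1 F (delay_rhs u t)}].
Proof.
have [au|] := pselect (adm u); last by exists u.
have [M M0 hM] := adm_bounded au.
have [|F [F0 lF dF]] := @primitive_exists R s T (L * M) _ (delay_rhs_measurable t0s au.1 au.2).
  apply: filterS aA => t aAt /andP[st tT].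
  have t0t := le_lt_trans t0s st.
  apply: delay_rhs_bound => //; [exact: ltW|exact: aAt|].
  by move=> r rt; apply: hM; apply: le_trans rt (ltW tT).
exists F => _; split => //.
  by exists `|L * M| => p q _ pq _; exact: lF.
by apply: filterS dF => t dF stT; apply/is_derive1P; exact: dF.
Qed.

Let P := projT1 (choice primitive_ex).
Let HP u : adm u -> [/\ forall t, t <= s -> P u t = 0,
  lipschitz_itv s T (P u) &
  {ae @lebesgue_measure R, forall t, s < t < T -> is_derive t 1 (P u) (delay_rhs u t)}].
Proof. exact: (projT2 (choice primitive_ex)). Qed.

(** The Picard map. For admissible [u] the term [P u] vanishes up to [s], so fixed points agree with
    [y] there. *)
Let step u t := y (Num.min t s) + P u t.

(** The rate depends on [u] only through its bound [M], which later gives all iterates a common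
    Lipschitz constant. *)
Let P_bound u M : adm u -> (forall r, r <= T -> `|u r| <= M) ->
  forall p q, p <= q -> q <= T -> `|P u q - P u p| <= L * M * (q - p).
Proof.
move=> au uM; have [P0 lP dP] := HP au.
have B : forall p q, s <= p -> p <= q -> q <= T -> `|P u q - P u p| <= L * M * (q - p).
  apply: ac_lipschitz_bound => //; first exact: lipschitz_ac.
  apply: filterS2 dP aA => t h1 h2 stT; exists (delay_rhs u t); first exact: h1.
  have /andP[st tT] := stT; have t0t := le_lt_trans t0s st.
  apply: delay_rhs_bound => //; [exact: ltW|exact: h2|].
  by move=> r rt; apply: uM; apply: le_trans rt (ltW tT).
have LM0 : 0 <= L * M.
  apply: mulr_ge0; first by rewrite addr_ge0// sumr_ge0.
  exact: le_trans (normr_ge0 _) (uM T (lexx T)).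
have Ps r : P u r = P u (Num.max r s).
  by have [sr|rs] := leP s r; [|rewrite P0 ?(ltW rs)// P0].
move=> p q pq qT; rewrite (Ps p) (Ps q).
apply: le_trans (B _ _ _ _ _) _; first by rewrite le_max lexx orbT.
- by rewrite le_max2.
- by rewrite ge_max qT.
- by rewrite ler_wpM2l// !maxEle; do !case: ifPn; rewrite -?ltNge => *; lra.
Qed.

Let step_adm u : adm u -> adm (step u).
Proof.
move=> au; have [P0 lP dP] := HP au; have [M M0 hM] := adm_bounded au.
split.
  move=> t tt0; have ts : t <= s by apply: le_trans t0s; exact: ltW.
  by rewrite /step P0// (min_idPl ts) y0// addr0.
have [K K0 hK] := lipschitz_itv_pos ly; exists (K + L * M) => p q t0p pq qT.
rewrite /step (_ : _ - _ = (y (Num.min q s) - y (Num.min p s)) + (P u q - P u p)); last by ring.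
rewrite mulrDl (le_trans (ler_normD _ _))// lerD//; last exact: P_bound.
apply: le_trans (hK _ _ _ _ _) _; first by rewrite le_min t0p.
- by rewrite le_min2.
- by rewrite ge_min qT.
- by rewrite ler_pM2l// !minEle; do !case: ifPn; rewrite -?ltNge => *; lra.
Qed.

Let E t := expR (2 * (L + 1) * (t - s)).

Let L0 : 0 <= L. Proof. by rewrite addr_ge0// sumr_ge0. Qed.

Let E_le p q : p <= q -> E p <= E q.
Proof.
move=> pq; rewrite /E ler_expR ler_wpM2l ?lerD2r// mulr_ge0// addr_ge0//.
Qed.

(* The weight E makes the Picard map a contraction with factor 1/2. *)
Let step_contract u v c : adm u -> adm v -> 0 <= c ->
  (forall t, t <= T -> `|u t - v t| <= c * E t) ->
  forall t, t <= T -> `|step u t - step v t| <= c / 2 * E t.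
Proof.
move=> au av c0 uv t tT.
have [Pu lPu dPu] := HP au; have [Pv lPv dPv] := HP av.
have c20 : 0 <= c / 2 by rewrite divr_ge0.
have E0 r : 0 <= E r by exact: expR_ge0.
rewrite /step (_ : _ - _ = P u t - P v t); last by ring.
have [ts|st] := leP t s; first by rewrite Pu// Pv// subrr normr0 mulr_ge0.
have lw : lipschitz_itv s t (P u - P v).
  by apply: lipschitz_itvB; apply: lipschitz_itvS (lexx s) tT _.
have : `|(P u - P v) t - (P u - P v) s| <= c / 2 * E t - c / 2 * E s.
  apply: (@ac_dominated _ s t _ (fun r => c / 2 * E r)); first exact: ltW.
  - exact: lipschitz_ac.
  - by apply: lipschitz_scaled_exp; rewrite mulr_ge0// addr_ge0.
  apply: filterS3 dPu dPv aA => r h1 h2 h3 /andP[sr rt].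
  have srT : s < r < T by rewrite sr (lt_le_trans rt).
  (* The derivative of [c / 2 * E] is [c * (L + 1) * E], which exceeds the bound [L * c * E] for the
     difference of the right-hand sides. *)
  exists (delay_rhs u r - delay_rhs v r), (c / 2 * (2 * (L + 1)) * E r); split.
  - by apply: is_deriveB; [exact: h1|exact: h2].
  - exact: is_derive_scaled_exp.
  rewrite -delay_rhsB.
  have t0r := le_lt_trans t0s sr.
  apply: le_trans (@delay_rhs_bound _ (c * E r) _ (ltW t0r) (h3 t0r) _) _.
    move=> q qr; apply: le_trans (uv _ _) _; last by rewrite ler_wpM2l// E_le.
    by rewrite (le_trans qr)// (le_trans (ltW rt)).
  rewrite (_ : c / 2 * (2 * (L + 1)) * E r = L * (c * E r) + c * E r); last by field.
  by rewrite lerDl mulr_ge0.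
rewrite -[(P u - P v) t]/(P u t - P v t) -[(P u - P v) s]/(P u s - P v s).
rewrite (Pu s (lexx s)) (Pv s (lexx s)) subrr subr0 => /le_trans; apply.
by rewrite lerBlDr lerDl mulr_ge0.
Qed.


(** The iterates start from [y] frozen after [s], converge geometrically in the weight [E] and share
    a Lipschitz constant. The limit is therefore admissible and a fixed point of [step], and it
    inherits the derivative of [P u]. *)
Lemma continuation_exists : exists u : R -> R,
  [/\ zero_before t0 u, lipschitz_itv t0 T u, forall t, t <= s -> u t = y t &
    {ae @lebesgue_measure R, forall t, s < t < T -> is_derive t 1 u (delay_rhs u t)}].
Proof.
pose u0 t := y (Num.min t s).
have au0 : adm u0.
  split.
    move=> t tt0; have ts : t <= s by apply: le_trans t0s; exact: ltW.
    by rewrite /u0 (min_idPl ts) y0.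
  have [K K0 hK] := lipschitz_itv_pos ly; exists K => p q t0p pq qT.
  apply: le_trans (hK _ _ _ _ _) _; first by rewrite le_min t0p.
  - by rewrite le_min2.
  - by rewrite ge_min qT.
  - by rewrite ler_pM2l// !minEle; do !case: ifPn; rewrite -?ltNge => *; lra.
pose U n := iter n step u0.
have aU n : adm (U n) by elim: n => //= n; exact: step_adm.
have [M0 M00 hM0] := adm_bounded au0.
have E0 r : 0 <= E r by exact: expR_ge0.
have [P0 lP dP] := HP au0.
(* Bound for the first difference, which is [P u0]. *)
pose c := L * M0 * (T - s).
have c0 : 0 <= c by rewrite !mulr_ge0// subr_ge0.
have UU n t : t <= T -> `|U n.+1 t - U n t| <= c * 2^-1 ^+ n * E t.
  elim: n t => [|n IH] t tT; last first.
    have q0 : 0 <= c * 2^-1 ^+ n by rewrite mulr_ge0// exprn_ge0.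
    rewrite exprSr mulrA; exact: (step_contract (aU n.+1) (aU n) q0 IH tT).
  rewrite /= expr0 mulr1 /step -/(u0 t) (_ : _ - _ = P u0 t); last by ring.
  have [ts|st] := leP t s; first by rewrite P0// normr0 mulr_ge0.
  have := P_bound au0 hM0 (ltW st) tT; rewrite (P0 _ (lexx s)) subr0 => hP.
  apply: le_trans hP _; apply: (@le_trans _ _ c).
    by apply: ler_wpM2l; [rewrite mulr_ge0|rewrite lerD2r].
  rewrite ler_peMr// -expR0 ler_expR mulr_ge0// ?subr_ge0 ?(ltW st)//.
  by rewrite mulr_ge0// addr_ge0.
have lim t : exists l, t <= T -> forall n, `|l - U n t| <= 2 * (c * E t) * 2^-1 ^+ n.
  have [tT|] := boolP (t <= T); last by exists 0.
  have [l hl] : exists l, forall n, `|l - U n t| <= 2 * (c * E t) * 2^-1 ^+ n.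
    apply: geometric_limit; first by rewrite mulr_ge0.
    by move=> n; rewrite mulrAC; exact: UU.
  by exists l.
pose u := projT1 (choice lim).
have hu t : t <= T -> forall n, `|u t - U n t| <= 2 * (c * E t) * 2^-1 ^+ n.
  exact: (projT2 (choice lim)).
pose c1 := 2 * (c * E T).
have c10 : 0 <= c1 by rewrite mulr_ge0// mulr_ge0.
have hu1 t n : t <= T -> `|u t - U n t| <= c1 * 2^-1 ^+ n.
  move=> tT; apply: le_trans (hu t tT n) _; rewrite ler_wpM2r ?exprn_ge0//.
  by rewrite ler_wpM2l// ler_wpM2l// E_le.
have half1 n : (2^-1 : R) ^+ n <= 1 by rewrite exprn_ile1//; lra.
have UM n t : t <= T -> `|U n t| <= M0 + 2 * c1.
  move=> tT; have h1 := hM0 t tT; have h3 := hu1 t n tT.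
  have h2 : `|u t - u0 t| <= c1 by have := hu1 t 0%N tT; rewrite expr0 mulr1.
  have h4 : c1 * 2^-1 ^+ n <= c1 by rewrite ler_piMr.
  have := ler_normD (U n t - u t) (u t - u0 t); have := ler_normD (U n t - u0 t) (u0 t).
  rewrite subrK addrA subrK (distrC (U n t) (u t)) => h5 h6.
  by move: h1 h2 h3 h4 h5 h6; set X1 := c1 * _; lra.
have [Ky Ky0 hKy] := lipschitz_itv_pos au0.2.
have au : adm u.
  split.
    move=> t tt0; apply/eqP; rewrite -normr_le0; apply: (@le_of_geometric _ _ _ c1) => n.
    have tT : t <= T by apply: le_trans t0T; exact: ltW.
    by have := hu1 t n tT; rewrite (aU n).1// subr0 add0r.
  exists (Ky + L * (M0 + 2 * c1)) => p q t0p pq qT.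
  have pT : p <= T := le_trans pq qT.
  apply: (@le_of_geometric _ _ _ (2 * c1)) => n.
  have h1 := hu1 p n.+1 pT; have h2 := hu1 q n.+1 qT.
  have h3 := P_bound (aU n) (UM n) pq qT.
  have h4 := hKy p q t0p pq qT.
  have h5 : `|U n.+1 q - U n.+1 p| <= (Ky + L * (M0 + 2 * c1)) * (q - p).
    rewrite /= /step -/(u0 q) -/(u0 p) mulrDl.
    rewrite (_ : _ - _ = (u0 q - u0 p) + (P (U n) q - P (U n) p)); last by ring.
    by rewrite (le_trans (ler_normD _ _))// lerD.
  rewrite (_ : u q - u p = (u q - U n.+1 q) + (U n.+1 q - U n.+1 p) - (u p - U n.+1 p));
    last by ring.
  apply: le_trans (ler_normB _ _) _; apply: le_trans (lerD (ler_normD _ _) (lexx _)) _.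
  have h6 : c1 * 2^-1 ^+ n.+1 <= c1 * 2^-1 ^+ n.
    by rewrite ler_wpM2l// exprS ler_piMl ?exprn_ge0//; lra.
  rewrite -!mulrA in h1 h2 h5 h6 *; lra.
have uE t : t <= T -> u t = step u t.
  move=> tT; apply/eqP; rewrite -subr_eq0 -normr_le0.
  apply: (@le_of_geometric _ _ _ (2 * (c * E t))) => n; rewrite add0r.
  have h1 := hu t tT n.+1.
  have h2 : `|step (U n) t - step u t| <= (2 * c * 2^-1 ^+ n) / 2 * E t.
    have q0 : 0 <= 2 * c * 2^-1 ^+ n.
      by apply: mulr_ge0; [exact: mulr_ge0|rewrite exprn_ge0].
    have hr r : r <= T -> `|U n r - u r| <= 2 * c * 2^-1 ^+ n * E r.
      move=> rT; rewrite distrC (le_trans (hu r rT n))// le_eqVlt; apply/orP; left.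
      by apply/eqP; ring.
    exact: (step_contract (aU n) au q0 hr tT).
  rewrite (_ : u t - step u t = (u t - U n.+1 t) + (step (U n) t - step u t)); last first.
    by rewrite /=; ring.
  apply: le_trans (ler_normD _ _) _.
  apply: le_trans (lerD h1 h2) _; rewrite exprS le_eqVlt; apply/orP; left.
  by apply/eqP; field.
have [Pu0 lPu dPu] := HP au.
exists u; split; [exact: au.1|exact: au.2| |].
  by move=> t ts; rewrite uE ?(le_trans ts)// /step (min_idPl ts) Pu0// addr0.
apply: filterS dPu => t h1 stT.
apply: (@is_derive_eq_itvoo _ (cst (y s) + P u) _ s T) => //.
  move=> r /andP[sr rT]; rewrite uE ?(ltW rT)// /step (min_idPr (ltW sr)).
  by [].
rewrite -[delay_rhs u t]add0r; apply: is_deriveD; exact: h1.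
Qed.

End delay_operator.

(** * Impulse response *)

Section impulse_response.
Context {R : realType} {m : nat}.
Variables (a h : 'I_m -> R -> R) (lam t0 T L : R) (tau rho : 'I_m -> R).
Hypothesis L0 : 0 <= L.
Hypothesis tau0 : forall k, 0 <= tau k.
Hypothesis rho0 : forall k, 0 <= rho k.
Hypothesis ht : forall k t, t0 <= t -> h k t <= t.
Hypothesis htau : forall k t, t0 <= t -> t - h k t <= tau k.
Hypothesis a_ge0 : forall t, t0 <= t -> 0 <= \sum_(k < m) a k t - lam.
Hypothesis a_rho : {ae @lebesgue_measure R, forall t, t0 < t ->
  forall k, `|a k t| <= rho k * (\sum_(j < m) a j t - lam)}.
Hypothesis rho1 : 1 <= \sum_(k < m) rho k.

Variables eps sg : R.
Hypothesis eps0 : 0 < eps.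

Hypothesis sgE : sg = \sum_(k < m) rho k * (tau k + eps).

(** [V t] bounds the source mass released up to time [t]: a jump at [s] is counted in [V s], and
    from [s + eps] on the total is [V0]. *)
Variables (s V0 : R) (y V : R -> R).
Hypotheses (t0s : t0 <= s) (sT : s <= T).
Hypothesis y0 : zero_before s y.
Hypothesis ly : lipschitz_itv s T y.
Hypothesis y_var : forall Y, (forall t, t <= T -> `|y t| <= Y) ->
  forall r t, s <= r -> r <= t -> t <= T -> `|y t - y r| <= L * Y * (t - r) + (V t - V r).
Hypothesis ys : `|y s| <= V s.
Hypothesis V_ge : forall t, s <= t -> t <= T -> V s <= V t.
Hypothesis V_le : forall t, s <= t -> t <= T -> V t <= V0.
Hypothesis V_cst : forall t, s + eps <= t -> t <= T -> V t = V0.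
Hypothesis dy : {ae @lebesgue_measure R, forall t, s + eps < t < T ->
  is_derive t 1 y (delay_rhs a h lam y t)}.

Let Vs0 : 0 <= V s. Proof. exact: le_trans (normr_ge0 _) ys. Qed.

(** Since the [rho k] add up to at least 1, the source is over before the time [s + sg] at which the
    damping argument starts. *)
Let eps_sg : eps <= sg.
Proof.
rewrite sgE; apply: (@le_trans _ _ (\sum_(k < m) rho k * eps)).
  by rewrite -mulr_suml ler_peMl// ltW.
by apply: ler_sum => k _; rewrite ler_wpM2l// lerDr.
Qed.

Let orders : [/\ t0 <= s, s <= T, 0 < eps & eps <= sg].
Proof. by split. Qed.

(* A delay whose window still meets [s, s + eps] at time r > s + sg satisfies
   tau k + eps > sg, so the weights rho of such delays add up to at most 1;
   this is what keeps the constant in front of V0 equal to 1. *)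
Let active_weight r : s + sg < r -> r <= T ->
  \sum_(k < m) (if h k r < s + eps then rho k else 0) <= 1.
Proof.
move=> sr rT; have sg0 : 0 < sg := lt_le_trans eps0 eps_sg.
have t0r : t0 <= r by have [? ? ? ?] := orders; lra.
rewrite -(ler_pM2r sg0) mul1r mulr_suml [leRHS]sgE; apply: ler_sum => k _.
case: ifPn => hk; last by rewrite mul0r mulr_ge0// addr_ge0// ltW.
by rewrite ler_wpM2l//; have := htau k t0r; have [? ? ? ?] := orders; lra.
Qed.

(** Three positions of the delayed time: before [s], where [y] vanishes and the whole of [y r]
    counts; during the source, costing at most [V0]; after it, where [V] is constant and only the
    rate [L * Y] is left. *)
Let delayed_increment Y r k : (forall t, t <= T -> `|y t| <= Y) ->
  s + sg < r -> r <= T ->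
  `|y r - y (h k r)| <= L * Y * (tau k + eps) + (if h k r < s + eps then 1 else 0) * V0.
Proof.
move=> yY sr rT; have sr' : s <= r by have [? ? ? ?] := orders; lra.
have t0r : t0 <= r := le_trans t0s sr'.
have Y0 : 0 <= Y := le_trans (normr_ge0 _) (yY T (lexx T)).
have LY0 : 0 <= L * Y by rewrite mulr_ge0.
have V00 : 0 <= V0 := le_trans Vs0 (V_le (lexx s) sT).
have [? ? ? ?] := orders; have hr := ht k t0r; have htk := htau k t0r.
have Lle d : d <= tau k -> L * Y * d <= L * Y * (tau k + eps).
  by move=> dt; rewrite ler_wpM2l//; lra.
have [qs|sq] := ltP (h k r) s.
  have -> : h k r < s + eps by lra.
  rewrite (y0 qs) subr0 mul1r.
  have h1 := y_var yY (lexx s) sr' rT; have h2 := V_le sr' rT.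
  have h3 : L * Y * (r - s) <= L * Y * (tau k + eps) by apply: Lle; lra.
  have := ler_normD (y r - y s) (y s); rewrite subrK; have := ys; lra.
have h1 := y_var yY sq hr rT; have h3 := Lle _ htk.
case: ifPn => hq.
  have h2 := V_le sr' rT; have h4 := V_ge sq (le_trans hr rT).
  by rewrite mul1r; have := Vs0; lra.
rewrite -leNgt in hq; rewrite mul0r addr0.
by move: h1; rewrite !V_cst//; [rewrite subrr addr0; lra| |]; lra.
Qed.

(** After division by the damping coefficient the weights are at most [rho k]: against [tau k + eps]
    they sum to [sg], and over the active delays to at most 1. *)
Let delayed_sum Y : (forall t, t <= T -> `|y t| <= Y) ->
  {ae @lebesgue_measure R, forall r, s + sg < r < T ->
    `|\sum_(k < m) a k r * (y r - y (h k r))| <=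
    (\sum_(k < m) a k r - lam) * (V0 + L * sg * Y)}.
Proof.
move=> yY; apply: filterS a_rho => r ar /andP[sr rT].
have sr' : s < r by have [? ? ? ?] := orders; lra.
have t0r : t0 < r := le_lt_trans t0s sr'.
have V00 : 0 <= V0 := le_trans Vs0 (V_le (lexx s) sT).
set at_ := _ - lam; have at0 : 0 <= at_ := a_ge0 (ltW t0r).
apply: (@le_trans _ _ (\sum_(k < m) at_ * (rho k * (L * Y * (tau k + eps) +
    (if h k r < s + eps then 1 else 0) * V0)))).
  apply: le_trans (ler_norm_sum _ _ _) _; apply: ler_sum => k _.
  rewrite normrM mulrA [at_ * _]mulrC; apply: ler_pM => //; first exact: ar.
  by apply: delayed_increment => //; exact: ltW.
rewrite -mulr_sumr ler_wpM2l//.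
rewrite (eq_bigr (fun k => L * Y * (rho k * (tau k + eps)) +
    (if h k r < s + eps then rho k else 0) * V0)); last first.
  by move=> k _; case: ifP => _; ring.
rewrite big_split/= -mulr_sumr -mulr_suml -sgE.
have := active_weight sr (ltW rT); set w := \sum_(k < m) _ => w1.
have : w * V0 <= 1 * V0 by rewrite ler_wpM2r.
by rewrite mul1r [L * sg * Y]mulrAC; lra.
Qed.

(** Up to [s + sg] the variation bound suffices. Later the comparison principle applies to [y] and
    to [- y]: above the level [V0 + L * sg * Y] the damping outweighs the delayed differences. *)
Let improve_bound Y : (forall t, t <= T -> `|y t| <= Y) ->
  forall t, s <= t -> t <= T -> `|y t| <= V0 + L * sg * Y.
Proof.
move=> yY t st tT.
have Y0 : 0 <= Y := le_trans (normr_ge0 _) (yY T (lexx T)).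
have LY0 : 0 <= L * Y by rewrite mulr_ge0.
have short r : s <= r -> r <= T -> r - s <= sg -> `|y r| <= V0 + L * sg * Y.
  move=> sr rT rsg; have h1 := y_var yY (lexx s) sr rT; have h2 := V_le sr rT.
  have h3 : L * Y * (r - s) <= L * Y * sg by rewrite ler_wpM2l.
  have := ler_normD (y r - y s) (y s); rewrite subrK [L * sg * Y]mulrAC.
  have := ys; lra.
have [|sgt] := leP (t - s) sg; first exact: short.
have s1t : s + sg <= t by lra.
have [? ? ? ?] := orders.
have ys1 : `|y (s + sg)| <= V0 + L * sg * Y by apply: short; lra.
have acy : abs_continuous_on (s + sg) t y.
  by apply: lipschitz_ac; apply: lipschitz_itvS ly; lra.
(* The instantaneous damping is split off from the delayed differences. *)
have dE r : delay_rhs a h lam y r =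
    - ((\sum_(k < m) a k r - lam) * y r) + \sum_(k < m) a k r * (y r - y (h k r)).
  rewrite /delay_rhs; under [X in _ = _ + X]eq_bigr do rewrite mulrBr.
  by rewrite sumrB -mulr_suml; ring.
have dyr r : s + sg < r < t -> s + eps < r < T.
  by move=> /andP[h1 h2]; apply/andP; split; lra.
have srT r : s + sg < r < t -> s + sg < r < T.
  by move=> /andP[h1 h2]; apply/andP; split; lra.
have a0r r : s + sg < r < t -> 0 <= \sum_(k < m) a k r - lam.
  by move=> /andP[h1 h2]; apply: a_ge0; lra.
move: ys1; rewrite !ler_norml => /andP[ys1 ys2]; apply/andP; split.
  rewrite lerNl; apply: (ac_le s1t (acN acy)); last by rewrite lerNl.
  apply: filterS2 dy (delayed_sum yY) => r h1 h2 hr Gy.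
  have /is_derive1P[? ->] := is_deriveN (h1 (dyr _ hr)).
  split => //; rewrite dE; move: (h2 (srT _ hr)) (a0r _ hr).
  rewrite ler_norml; set at_ := _ - lam; set S := \sum_(k < m) _ => /andP[h3 h4] at0.
  have : at_ * (V0 + L * sg * Y) <= at_ * - y r by rewrite ler_wpM2l// ltW.
  by rewrite mulrN; lra.
apply: (ac_le s1t acy) => //.
apply: filterS2 dy (delayed_sum yY) => r h1 h2 hr Gy.
have /is_derive1P[? ->] := h1 (dyr _ hr).
split => //; rewrite dE; move: (h2 (srT _ hr)) (a0r _ hr).
rewrite ler_norml; set at_ := _ - lam; set S := \sum_(k < m) _ => /andP[h3 h4] at0.
have : at_ * (V0 + L * sg * Y) <= at_ * y r by rewrite ler_wpM2l// ltW.
lra.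
Qed.

(** [improve_bound] is applied to the supremum of [|y|], finite by the Lipschitz property, and the
    term [L * sg] is absorbed. *)
Lemma impulse_bound : L * sg <= 1 -> `|y T| * (1 - L * sg) <= V0.
Proof.
move=> Lsg; pose S := [set `|y t| | t in `[s, T]].
have [M M0 hM] := lipschitz_itv_bounded ly.
have ubS : has_ubound S by exists M => _ [t + <-]; rewrite /= in_itv/=; exact: hM.
have SyT : S `|y T| by exists T => //=; rewrite in_itv/= sT lexx.
have yS t : t <= T -> `|y t| <= sup S.
  move=> tT; have [ts|st] := ltP t s.
    rewrite y0// normr0; apply: le_trans (normr_ge0 (y T)) _.
    exact: ub_le_sup.
  by apply: ub_le_sup => //; exists t => //=; rewrite in_itv/= st tT.
have : sup S <= V0 + L * sg * sup S.
  apply: ge_sup; first by exists `|y T|.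
  move=> _ [t + <-]; rewrite /= in_itv/= => /andP[st tT].
  exact: improve_bound.
have : `|y T| * (1 - L * sg) <= sup S * (1 - L * sg).
  by rewrite ler_wpM2r ?subr_ge0// yS.
by rewrite mulrBr mulr1 [sup S * _]mulrC mulrBl mul1r; lra.
Qed.

End impulse_response.

(** * Superposition *)

Section superposition.
Context {R : realType} {m : nat}.
Variables (a h : 'I_m -> R -> R) (lam t0 T : R) (A tau rho : 'I_m -> R).
Hypotheses (lam0 : 0 <= lam) (t0T : t0 <= T).
Hypothesis A0 : forall k, 0 <= A k.
Hypothesis tau0 : forall k, 0 <= tau k.
Hypothesis rho0 : forall k, 0 <= rho k.
Hypothesis ht : forall k t, t0 <= t -> h k t <= t.
Hypothesis htau : forall k t, t0 <= t -> t - h k t <= tau k.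
Hypothesis aA : {ae @lebesgue_measure R, forall t, t0 < t -> forall k, `|a k t| <= A k}.
Hypothesis ma : forall k, leb_measurable_on `[t0, +oo[ (a k).
Hypothesis mh : forall k, leb_measurable_on `[t0, +oo[ (h k).
Hypothesis a_ge0 : forall t, t0 <= t -> 0 <= \sum_(k < m) a k t - lam.
Hypothesis a_rho : {ae @lebesgue_measure R, forall t, t0 < t ->
  forall k, `|a k t| <= rho k * (\sum_(j < m) a j t - lam)}.
Hypothesis rho1 : 1 <= \sum_(k < m) rho k.

Let L := lam + \sum_(k < m) A k.

Let L0 : 0 <= L. Proof. by rewrite addr_ge0// sumr_ge0. Qed.

Variables y V : R -> R.
Hypothesis y0 : zero_before t0 y.
Hypothesis ly : lipschitz_itv t0 T y.
Hypothesis lV : lipschitz_itv t0 T V.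
Hypothesis V_homo : forall r t, t0 <= r -> r <= t -> t <= T -> V r <= V t.
Hypothesis yt0 : `|y t0| <= V t0.
Hypothesis dy : {ae @lebesgue_measure R, forall t, t0 < t < T -> exists d e,
  [/\ is_derive t 1 y d, is_derive t 1 V e & `|d - delay_rhs a h lam y t| <= e]}.

(** The source acts only up to [s], hence the truncation of [V] at [s]; beyond it the rate is
    [L * Y] alone. *)
Let variation p s d : t0 <= p -> p <= s -> s <= T -> lipschitz_itv p T d ->
  {ae @lebesgue_measure R, forall t, p < t < s -> exists d' e,
    [/\ is_derive t 1 d d', is_derive t 1 V e & `|d' - delay_rhs a h lam d t| <= e]} ->
  {ae @lebesgue_measure R, forall t, s < t < T ->
     is_derive t 1 d (delay_rhs a h lam d t)} ->
  forall Y, (forall t, t <= T -> `|d t| <= Y) ->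
  forall r t, p <= r -> r <= t -> t <= T ->
    `|d t - d r| <= L * Y * (t - r) + (V (Num.min t s) - V (Num.min r s)).
Proof.
move=> t0p ps sT ld dd1 dd2 Y dY.
have rhsY : {ae @lebesgue_measure R, forall t, p < t < T -> `|delay_rhs a h lam d t| <= L * Y}.
  apply: filterS aA => t h1 /andP[pt tT]; have t0t := le_lt_trans t0p pt.
  apply: (delay_rhs_bound lam0 ht (ltW t0t) (h1 t0t)).
  by move=> r rt; apply: dY; apply: le_trans rt (ltW tT).
have before r t : p <= r -> r <= t -> t <= s ->
    `|d t - d r| <= L * Y * (t - r) + (V t - V r).
  move=> pr rt ts.
  have wE q : ( *%R (L * Y) - (- V)) q = L * Y * q + V q.
    by rewrite -[LHS]/(L * Y * q - - V q) opprK.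
  rewrite (_ : L * Y * (t - r) + _ = ( *%R (L * Y) - (- V)) t - ( *%R (L * Y) - (- V)) r); last first.
    by rewrite !wE; ring.
  have tT := le_trans ts sT.
  apply: ac_dominated => //.
  - by apply: lipschitz_ac; apply: lipschitz_itvS ld.
  - apply: lipschitz_itvB; first exact: lipschitz_itv_linear.
    have [K hK] := lV; exists K => x z rx xz zt.
    rewrite -[(- V) z]/(- V z) -[(- V) x]/(- V x) -opprD normrN.
    by apply: hK => //; [rewrite (le_trans t0p)// (le_trans pr)|rewrite (le_trans zt)].
  apply: filterS2 dd1 rhsY => q h1 h2 /andP[rq qt].
  have pq := le_lt_trans pr rq.
  have [|d' [e [? ? de]]] := h1; first by rewrite pq (lt_le_trans qt).
  exists d', (L * Y - - e); split => //.
    by apply: is_deriveB; first exact: is_derive_linear.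
  rewrite opprK -(subrK (delay_rhs a h lam d q) d') addrC.
  by rewrite (le_trans (ler_normD _ _))// lerD// h2// pq (lt_le_trans qt).
have after r t : s <= r -> r <= t -> t <= T -> `|d t - d r| <= L * Y * (t - r).
  have acd : abs_continuous_on s T d by apply: lipschitz_ac; apply: lipschitz_itvS ld.
  apply: (ac_lipschitz_bound sT acd).
  apply: filterS2 dd2 rhsY => q h1 h2 sqT; exists (delay_rhs a h lam d q); first exact: h1.
  by apply: h2; move/andP: sqT => [sq ->]; rewrite (le_lt_trans ps).
move=> r t pr rt tT.
have [ts|st] := leP t s.
  by rewrite (min_idPl (le_trans rt ts)); exact: before.
have [rs|sr] := leP r s; last first.
  by rewrite subrr addr0; apply: after => //; exact: ltW.
have h1 := before r s pr rs (lexx s); have h2 := after s t (lexx s) (ltW st) tT.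
rewrite -(subrK (d s) (d t)) -addrA (le_trans (ler_normD _ _))//.
by move: h1 h2; rewrite !mulrBr; lra.
Qed.

Variables eps sg : R.
Hypothesis eps0 : 0 < eps.
Hypothesis sgE : sg = \sum_(k < m) rho k * (tau k + eps).
Hypothesis Lsg : L * sg <= 1.

(** [u] is the response when the source is switched off at time [s]. *)
Let continuation s u := [/\ zero_before t0 u, lipschitz_itv t0 T u,
  forall t, t <= s -> u t = y t &
  {ae @lebesgue_measure R, forall t, s < t < T -> is_derive t 1 u (delay_rhs a h lam u t)}].

Let rhs_before s u t : t0 <= t -> (forall t, t <= s -> u t = y t) -> t <= s ->
  delay_rhs a h lam u t = delay_rhs a h lam y t.
Proof.
move=> t0t uy ts; rewrite /delay_rhs uy//; congr (_ - _); apply: eq_bigr => k _.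
by rewrite uy// (le_trans (ht k t0t)).
Qed.

Let derive_before s u d t : t < s -> (forall t, t <= s -> u t = y t) ->
  is_derive t 1 y d -> is_derive t 1 u d.
Proof.
move=> ts uy; apply: (@is_derive_eq_itvoo _ y u (t - 1) s).
  by rewrite ts andbT gtrBl.
by move=> r /andP[_ rs]; rewrite uy// ltW.
Qed.

(** The jump at [t0] and the source up to [s] form a single impulse of mass [V s]. *)
Let near_start s u : t0 <= s -> s <= T -> s <= t0 + eps ->
  continuation s u -> `|u T| * (1 - L * sg) <= V s.
Proof.
move=> t0s sT seps [u0 lu uy du].
apply: (impulse_bound L0 tau0 rho0 ht htau a_ge0 a_rho rho1 eps0 sgE
  (s := t0) (y := u) (V := fun t => V (Num.min t s))) => //.
- apply: variation => //; apply: filterS dy => t h1 /andP[t0t ts].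
  have [|d [e [dyt dVt de]]] := h1; first by rewrite t0t (lt_le_trans ts).
  exists d, e; split => //; first exact: (derive_before ts uy dyt).
  by rewrite (rhs_before (ltW t0t) uy (ltW ts)).
- by rewrite (min_idPl t0s) uy.
- move=> t t0t tT; rewrite (min_idPl t0s); apply: V_homo => //.
    by rewrite le_min t0t.
  by rewrite ge_min tT.
- move=> t t0t tT; apply: V_homo => //; first by rewrite le_min t0t.
  by rewrite ge_min lexx orbT.
- by move=> t et tT; rewrite (min_idPr _)// (le_trans seps).
- apply: filterS du => t h1 /andP[et tT]; apply: h1.
  by rewrite tT (le_lt_trans seps).
Qed.

(* The response to a source supported in [s, s'], with s' <= s + eps. *)
Let increment s s' u u' : t0 <= s -> s <= s' -> s' <= T -> s' <= s + eps ->
  continuation s u -> continuation s' u' ->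
  `|u' T - u T| * (1 - L * sg) <= V s' - V s.
Proof.
move=> t0s ss' s'T s'e [u0 lu uy du] [v0 lv vy dv].
have sT : s <= T := le_trans ss' s'T.
have ldiff : lipschitz_itv s T (u' - u).
  by apply: lipschitz_itvB; exact: (lipschitz_itvS t0s (lexx T)).
have dE t : (u' - u) t = u' t - u t by [].
rewrite -dE; apply: (impulse_bound L0 tau0 rho0 ht htau a_ge0 a_rho rho1 eps0 sgE
  (s := s) (V := fun t => V (Num.min t s') - V s)) => //.
- by move=> t ts; rewrite dE uy ?vy ?subrr// ltW// (lt_le_trans ts).
- move=> Y hY r t sr rt tT.
  rewrite (_ : _ - V s - _ = V (Num.min t s') - V (Num.min r s')); last by ring.
  apply: (variation t0s ss' s'T ldiff) => //.
    apply: filterS2 dy du => q h1 h2 /andP[sq qs'].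
    have qT : q < T := lt_le_trans qs' s'T.
    have t0q : t0 < q := le_lt_trans t0s sq.
    have [|d [e [dyt dVt de]]] := h1; first by rewrite t0q.
    exists (d - delay_rhs a h lam u q), e; split => //.
      by apply: is_deriveB; [exact: (derive_before qs' vy dyt)|apply: h2; rewrite sq].
    rewrite delay_rhsB (rhs_before (ltW t0q) vy (ltW qs')).
    by rewrite (_ : _ - _ = d - delay_rhs a h lam y q)//; ring.
  apply: filterS2 dv du => q h1 h2 /andP[sq qT].
  rewrite delay_rhsB; apply: is_deriveB; first by apply: h1; rewrite sq.
  by apply: h2; rewrite qT andbT (le_lt_trans ss').
- by rewrite dE uy// vy// (min_idPl ss') !subrr normr0.
- move=> t st tT; rewrite lerD2r (min_idPl ss'); apply: V_homo => //.
    by rewrite le_min st.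
  by rewrite ge_min tT.
- move=> t st tT; rewrite lerD2r; apply: V_homo => //.
    by rewrite le_min (le_trans t0s st) (le_trans t0s).
  by rewrite ge_min lexx orbT.
- by move=> t et tT; rewrite (min_idPr _)// (le_trans s'e).
- apply: filterS2 dv du => q h1 h2 /andP[sq qT].
  have s'q : s' < q := le_lt_trans s'e sq.
  rewrite delay_rhsB; apply: is_deriveB; first by apply: h1; rewrite s'q.
  by apply: h2; rewrite qT andbT (le_lt_trans ss').
Qed.

(** Induction backwards in steps of [eps]: the masses of the successive impulses telescope to
    [V s]. *)
Let continuation_bound n s u : t0 <= s -> s <= T -> s - t0 <= n%:R * eps ->
  continuation s u -> `|u T| * (1 - L * sg) <= V s.
Proof.
have sg1 : 0 <= 1 - L * sg by rewrite subr_ge0.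
elim: n s u => [|n IH] s u t0s sT sn cu.
  by apply: near_start => //; rewrite mul0r in sn; rewrite -lerBlDl (le_trans sn)// ltW.
have [se|es] := leP s (t0 + eps); first exact: near_start.
have t0s' : t0 <= s - eps by rewrite lerBrDr ltW.
have s's : s - eps <= s by rewrite gerBl ltW.
have s'T : s - eps <= T := le_trans s's sT.
have [w cw] := continuation_exists lam0 t0T A0 ht aA ma mh t0s' s'T y0 ly.
have h1 : `|w T| * (1 - L * sg) <= V (s - eps).
  apply: IH cw => //; move: sn; rewrite -natr1 mulrDl mul1r => sn.
  by rewrite addrAC lerBlDr.
have h2 : `|u T - w T| * (1 - L * sg) <= V s - V (s - eps).
  by apply: increment cw cu => //; rewrite subrK.
have h3 : `|u T| * (1 - L * sg) <= (`|u T - w T| + `|w T|) * (1 - L * sg).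
  by rewrite ler_wpM2r// -{1}(subrK (w T) (u T)) ler_normD.
by apply: le_trans h3 _; rewrite mulrDl; move: h1 h2; lra.
Qed.

Lemma superposition_bound : `|y T| * (1 - L * sg) <= V T.
Proof.
pose n := Num.bound `|(T - t0) / eps|.
apply: (@continuation_bound n) => //.
  rewrite -ler_pdivrMr//; apply: le_trans (ler_norm _) _.
  by apply: ltW; exact: archi_boundP.
(* With the source switched off only at [T], [y] is its own continuation: no time lies strictly
   between [T] and [T]. *)
split => //; apply: filterE => t /andP[h1 h2].
by have := lt_trans h1 h2; rewrite ltxx.
Qed.

End superposition.

(** * Essential norms and almost-everywhere statements *)

Lemma ae_exists (R : realType) (p q : R) (P : R -> Prop) : p < q ->
  {ae @lebesgue_measure R, forall t, P t} -> exists2 t, p < t < q & P t.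
Proof.
move=> pq [N [mN N0 hN]]; apply: contrapT => hP.
have sub : `]p, q[ `<=` N.
  move=> t /=; rewrite in_itv/= => tpq; apply: hN => Pt; apply: hP; by exists t.
have : (lebesgue_measure (`]p, q[ : set R) <= lebesgue_measure N)%E.
  by apply: le_measure; rewrite ?inE//; exact: measurable_itv.
by rewrite N0 lebesgue_measure_itv/= lte_fin pq -EFinB lee_fin subr_le0 leNgt pq.
Qed.

Lemma ae_neq (R : realType) (c : R) : {ae @lebesgue_measure R, forall t, t != c}.
Proof.
exists [set c]; split; [exact: measurable_set1|exact: lebesgue_measure_set1|].
by move=> t /= /negP; rewrite negbK => /eqP.
Qed.

Lemma ess_norm_ge0 (R : realType) (g : R -> R) (J : set R) : (0 <= ess_norm g J)%E.
Proof.
(* Positive total measure is what lets a pointwise lower bound pass to the essential supremum. *)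
have muT : (0 < lebesgue_measure [set: R])%E.
  apply: (@lt_le_trans _ _ (lebesgue_measure (`]0, 1[ : set R))).
    by rewrite lebesgue_measure_itv/= lte_fin ltr01 -EFinB lte_fin subr0.
  by apply: le_measure; rewrite ?inE//; exact: measurable_itv.
apply: ess_sup_gee; first exact: muT.
by apply: filterE => t; rewrite lee_fin mulr_ge0// indicE.
Qed.

Lemma rnorm_ge0 (R : realType) (g : R -> R) (J : set R) : 0 <= rnorm g J.
Proof. by apply: fine_ge0; exact: ess_norm_ge0. Qed.

(** Finiteness matters: [fine] sends an infinite norm to 0. *)
Lemma ae_le_rnorm (R : realType) (g : R -> R) (J : set R) : (ess_norm g J < +oo)%E ->
  {ae @lebesgue_measure R, forall t, J t -> `|g t| <= rnorm g J}.
Proof.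
move=> gJ; have gfin : ess_norm g J \is a fin_num by rewrite ge0_fin_numE ?ess_norm_ge0.
apply: filterS (ess_sup_ge (@lebesgue_measure R) (fun t => ((\1_J t : R) * `|g t|)%:E)).
move=> t ht Jt; rewrite -lee_fin fineK//; apply: le_trans ht.
by rewrite indicE mem_set// mul1r.
Qed.

Lemma ess_norm_lty (R : realType) (g : R -> R) (J : set R) (C : R) :
  {ae @lebesgue_measure R, forall t, J t -> `|g t| <= C} -> (ess_norm g J < +oo)%E.
Proof.
move=> h; apply: (@le_lt_trans _ _ `|C|%:E); last exact: ltry.
apply/ess_supP; apply: filterS h => t ht; rewrite lee_fin indicE.
case: (boolP (t \in J)) => [|_]; last by rewrite mul0r.
by rewrite inE => /ht tC; rewrite mul1r (le_trans tC)// ler_norm.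
Qed.

(** * The exponentially weighted solution *)

Section exponential_weight.
Context {R : realType} {m : nat}.
Variables (b h : 'I_m -> R -> R) (f x : R -> R) (lam t0 T : R).
Variables (B tau : 'I_m -> R) (Fn Phi : R).
Hypotheses (lam0 : 0 < lam) (t0T : t0 <= T).
Hypotheses (B0 : forall k, 0 <= B k) (tau0 : forall k, 0 <= tau k).
Hypotheses (Fn0 : 0 <= Fn) (Phi0 : 0 <= Phi).
Hypothesis ht : forall k t, t0 <= t -> h k t <= t.
Hypothesis htau : forall k t, t0 <= t -> t - h k t <= tau k.
Hypothesis bB : {ae @lebesgue_measure R, forall t, t0 < t -> forall k, `|b k t| <= B k}.
Hypothesis fF : {ae @lebesgue_measure R, forall t, t0 < t < T -> `|f t| <= Fn}.
Hypothesis x_history : forall k t, t0 <= t -> h k t < t0 -> `|x (h k t)| <= Phi.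
Hypothesis acx : abs_continuous_on t0 T x.
Hypothesis dx : {ae @lebesgue_measure R, forall t, t0 < t ->
  is_derive t 1 x (f t - \sum_(k < m) b k t * x (h k t))}.

Definition weighted_coef k t := expR (lam * (t - h k t)) * b k t.

Definition weighted_solution t := if t < t0 then 0 else expR (lam * (t - t0)) * x t.

(* The value at t is |x t0| plus the integral over [t0, t] of an a.e. bound on the forcing
   e^(lam (s - t0)) (f s - \sum_k b_k(s) phi(h_k s) [h_k s < t0]): the history
   term of index k is active only until t0 + tau k. *)
Definition source_majorant t :=
  Fn / lam * expR (lam * (t - t0)) +
  \sum_(k < m) B k * Phi / lam * expR (lam * (Num.min t (t0 + tau k) - t0)) +
  (`|x t0| - Fn / lam - \sum_(k < m) B k * Phi / lam).

Lemma weighted_zero_before : zero_before t0 weighted_solution.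
Proof. by move=> t tt0; rewrite /weighted_solution tt0. Qed.

Lemma source_majorant_start : `|weighted_solution t0| <= source_majorant t0.
Proof.
rewrite /weighted_solution ltxx /source_majorant subrr mulr0 expR0 mul1r mulr1.
rewrite (eq_bigr (fun k => B k * Phi / lam)); last first.
  move=> k _; rewrite (min_idPl _) ?lerDl// subrr mulr0 expR0 mulr1//.
by set S := \sum_(k < m) _; lra.
Qed.

(** The solution is bounded on the interval by absolute continuity, so the equation bounds its
    derivative; [X + Phi] covers delayed values on either side of [t0]. *)
Let lipschitz_x : lipschitz_itv t0 T x.
Proof.
have [X X0 hX] := ac_bounded t0T acx.
exists (Fn + \sum_(k < m) B k * (X + Phi)).
apply: (ac_lipschitz_bound t0T acx); apply: filterS3 dx bB fF => t h1 h2 h3 /andP[t0t tT].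
exists (f t - \sum_(k < m) b k t * x (h k t)); first exact: h1.
rewrite (le_trans (ler_normB _ _))// lerD// ?h3 ?t0t//.
rewrite (le_trans (ler_norm_sum _ _ _))// ler_sum// => k _.
rewrite normrM ler_pM// ?h2//.
have [hk|hk] := ltP (h k t) t0.
  by rewrite (le_trans (x_history (ltW t0t) hk))// lerDr.
by rewrite (le_trans (hX _ _)) ?lerDl// hk (le_trans (ht k (ltW t0t)))// ltW.
Qed.

Lemma weighted_lipschitz : lipschitz_itv t0 T weighted_solution.
Proof.
have [K hK] : lipschitz_itv t0 T (fun t => expR (lam * (t - t0)) * x t).
  apply: lipschitz_itvM lipschitz_x.
  have [K hK] := @lipschitz_scaled_exp R 1 lam t0 t0 T (ltW lam0).
  by exists K => s t t0s st tT; have := hK s t t0s st tT; rewrite !mul1r.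
exists K => s t t0s st tT; rewrite /weighted_solution !ltNge t0s (le_trans t0s st)/=.
exact: hK.
Qed.

Lemma source_majorant_lipschitz : lipschitz_itv t0 T source_majorant.
Proof.
have [K hK] : lipschitz_itv t0 T (fun t => Fn / lam * expR (lam * (t - t0))).
  exact: lipschitz_scaled_exp (ltW lam0).
have [N hN] : lipschitz_itv t0 T (fun t =>
    \sum_(k < m) B k * Phi / lam * expR (lam * (Num.min t (t0 + tau k) - t0))).
  apply: lipschitz_itv_sum => k.
  have /lipschitz_itv_pos[K' K'0 hK'] :=
    @lipschitz_scaled_exp R (B k * Phi / lam) lam t0 t0 T (ltW lam0).
  exists K' => s t t0s st tT; apply: le_trans (hK' _ _ _ _ _) _.
  - by rewrite le_min t0s/= lerDl.
  - by rewrite le_min2.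
  - by rewrite ge_min tT.
  - by rewrite ler_pM2l// !minEle; do !case: ifPn; rewrite -?ltNge => *; lra.
exists (K + N) => s t t0s st tT; rewrite /source_majorant.
set F1 := \sum_(k < m) _; set F2 := \sum_(k < m) _ in F1 *.
rewrite mulrDl; apply: le_trans (lerD (hK s t t0s st tT) (hN s t t0s st tT)).
rewrite opprD addrACA subrr addr0 opprD addrACA; exact: ler_normD.
Qed.

Lemma source_majorant_homo r t : t0 <= r -> r <= t -> t <= T ->
  source_majorant r <= source_majorant t.
Proof.
move=> t0r rt tT; rewrite /source_majorant lerD2r; apply: lerD.
  by rewrite ler_wpM2l ?divr_ge0 ?(ltW lam0)// ler_expR ler_pM2l// lerD2r.
apply: ler_sum => k _; rewrite ler_wpM2l ?divr_ge0 ?mulr_ge0 ?(ltW lam0)//.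
by rewrite ler_expR ler_pM2l// lerD2r le_min2.
Qed.

(** The truncated exponentials have kinks only at the excluded points [t0 + tau k]. *)
Let majorant_derive t : t0 < t -> (forall k, t != t0 + tau k) ->
  is_derive t 1 source_majorant (Fn * expR (lam * (t - t0)) +
    \sum_(k < m) (if t < t0 + tau k then B k * Phi * expR (lam * (t - t0)) else 0)).
Proof.
move=> t0t tne.
have D1 : is_derive t 1 (fun r => Fn / lam * expR (lam * (r - t0)))
    (Fn * expR (lam * (t - t0))).
  have := @is_derive_scaled_exp R (Fn / lam) lam t0 t.
  by rewrite divfK ?gt_eqF.
have D2 k : is_derive t 1
    (fun r => B k * Phi / lam * expR (lam * (Num.min r (t0 + tau k) - t0)))
    (if t < t0 + tau k then B k * Phi * expR (lam * (t - t0)) else 0).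
  case: ifPn => tk.
    apply: (@is_derive_eq_itvoo _
      (fun r => B k * Phi / lam * expR (lam * (r - t0))) _ (t - 1) (t0 + tau k)).
    - by rewrite tk andbT gtrBl.
    - by move=> r /andP[_ rk]; rewrite (min_idPl (ltW rk)).
    - have := @is_derive_scaled_exp R (B k * Phi / lam) lam t0 t.
      by rewrite divfK ?gt_eqF.
  have {}tk : t0 + tau k < t by rewrite lt_neqAle leNgt tk andbT eq_sym.
  apply: (@is_derive_eq_itvoo _
    (cst (B k * Phi / lam * expR (lam * (t0 + tau k - t0)))) _ (t0 + tau k) (t + 1)).
  - by rewrite tk/= ltrDl.
  - by move=> r /andP[rk _]; rewrite (min_idPr (ltW rk)).
have D3 : is_derive t 1
    (\sum_(k < m) (fun r => B k * Phi / lam * expR (lam * (Num.min r (t0 + tau k) - t0))))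
    (\sum_(k < m) (if t < t0 + tau k then B k * Phi * expR (lam * (t - t0)) else 0)).
  exact: is_derive_sum.
have := is_deriveD (is_deriveD D1 D3)
  (is_derive_cst (`|x t0| - Fn / lam - \sum_(k < m) B k * Phi / lam) t 1).
rewrite addr0; congr (is_derive _ _ _ _).
by apply/funext => r; rewrite /source_majorant -[LHS]/(_ + _ + _) fct_sumE.
Qed.

Lemma weighted_equation : {ae @lebesgue_measure R, forall t, t0 < t < T -> exists d e,
  [/\ is_derive t 1 weighted_solution d, is_derive t 1 source_majorant e &
      `|d - delay_rhs weighted_coef h lam weighted_solution t| <= e]}.
Proof.
have tne : {ae @lebesgue_measure R, forall t k, t != t0 + tau k}.
  by apply: filter_forall => k; exact: ae_neq.
have bF : {ae @lebesgue_measure R, forall t, t0 < t < T ->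
    (forall k, `|b k t| <= B k) /\ `|f t| <= Fn}.
  apply: filterS2 bB fF => t h1 h2 h3; split; last exact: h2.
  by case/andP: h3 => + _; exact: h1.
apply: filterS3 dx bF tne => t h1 h2 h3 tI.
have [bk ft] := h2 tI; have /andP[t0t tT] := tI; have t0t' := ltW t0t.
set E := expR (lam * (t - t0)).
set S := \sum_(k < m) b k t * x (h k t).
have E0 : 0 <= E by exact: expR_ge0.
exists (E * (f t - S) + x t * (lam * E)), (Fn * E +
  \sum_(k < m) (if t < t0 + tau k then B k * Phi * E else 0)); split.
- apply: (@is_derive_eq_itvoo _ (fun r => expR (lam * (r - t0)) * x r) _ t0 T t _ tI).
    by move=> r /andP[t0r _]; rewrite /weighted_solution ltNge (ltW t0r).
  have De : is_derive t 1 (fun r : R => expR (lam * (r - t0))) (lam * E).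
    have := @is_derive_scaled_exp R 1 lam t0 t; rewrite !mul1r.
    by under eq_fun do rewrite mul1r.
  exact: (is_deriveM De (h1 t0t)).
- exact: majorant_derive.
(* The exponential factors through the delayed time, so a delayed term cancels unless it reads the
   history. *)
have xw k : expR (lam * (t - t0)) * (b k t * x (h k t)) -
    weighted_coef k t * weighted_solution (h k t) =
    if h k t < t0 then E * (b k t * x (h k t)) else 0.
  rewrite /weighted_coef /weighted_solution; case: ifPn => _; first by rewrite mulr0 subr0.
  rewrite (_ : expR (lam * (t - t0)) =
    expR (lam * (t - h k t)) * expR (lam * (h k t - t0))); first by ring.
  by rewrite -expRD; congr expR; ring.
have wt : weighted_solution t = E * x t by rewrite /weighted_solution ltNge t0t'.
have -> : E * (f t - S) + x t * (lam * E) -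
    delay_rhs weighted_coef h lam weighted_solution t =
    E * f t - \sum_(k < m) (if h k t < t0 then E * (b k t * x (h k t)) else 0).
  rewrite /delay_rhs wt -(eq_bigr _ (fun k _ => xw k)) sumrB -mulr_sumr -/S -/E.
  by ring.
rewrite (le_trans (ler_normB _ _))//; apply: lerD.
  by rewrite normrM (ger0_norm E0) mulrC ler_wpM2r.
rewrite (le_trans (ler_norm_sum _ _ _))//; apply: ler_sum => k _.
case: ifPn => hk.
  (* A term that reads the history satisfies [t - tau k <= h k t < t0]. *)
  have -> : t < t0 + tau k by have := htau k t0t'; lra.
  rewrite !normrM (ger0_norm E0) mulrC ler_wpM2r// ler_pM//.
  exact: x_history.
by rewrite normr0; case: ifP => // _; rewrite !mulr_ge0.
Qed.

End exponential_weight.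

(** * Removal of the step length and proof of the estimate *)

(** Lets [e] tend to 0 along halvings of a first value small enough for [q + e * c <= 1]. *)
Lemma le_of_perturbation (R : realType) (q c Y V : R) : 0 <= c -> 0 <= Y -> q < 1 ->
  (forall e, 0 < e -> q + e * c <= 1 -> Y * (1 - (q + e * c)) <= V) ->
  Y * (1 - q) <= V.
Proof.
move=> c0 Y0 q1 H; pose e := (1 - q) / (c + 1).
have c1 : 0 < c + 1 by lra.
have e0 : 0 < e by rewrite divr_gt0// subr_gt0.
have ec : e * c <= 1 - q by rewrite mulrAC ler_pdivrMr// ler_wpM2l//; lra.
apply: (@le_of_geometric _ _ _ (Y * (e * c))) => n.
have h0 : 0 < (2^-1 : R) ^+ n by rewrite exprn_gt0.
have h1 : (2^-1 : R) ^+ n <= 1 by rewrite exprn_ile1//; lra.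
have ec0 : 0 <= e * c by rewrite mulr_ge0// ltW.
have h2 : e * c * 2^-1 ^+ n <= e * c by rewrite ler_piMr.
have := H (e * 2^-1 ^+ n) (mulr_gt0 e0 h0).
rewrite (mulrAC e) => h3; have := h3 _; rewrite -mulrA.
have {}h3 : Y * (1 - (q + e * c * 2^-1 ^+ n)) <= V by apply: h3; lra.
by move=> _; move: h3; rewrite !mulrA !mulrBr !mulrDr !mulrA; lra.
Qed.

Theorem theorem4p1 (R : realType) (t0 : R) (m : nat)
    (b h : 'I_m -> R -> R) (delta tau_ : 'I_m -> R)
    (f phi x : R -> R) (lam alpha : R) :
  0 <= t0 -> (0 < m)%N ->
  (forall k, leb_measurable_on `[0%R, +oo[ (b k)) ->
  (forall k, (ess_norm (b k) `[0%R, +oo[ < +oo)%E) ->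
  (forall k, leb_measurable_on `[0%R, +oo[ (h k)) ->
  (forall k, 0 <= delta k <= tau_ k) ->
  (forall k t, t0 <= t -> delta k <= t - h k t <= tau_ k) ->
  let tau := \big[Num.max/0]_(k < m) tau_ k in
  leb_measurable_on `[t0%R, +oo[ f ->
  (forall T, t0 <= T -> (ess_norm f `[t0, T] < +oo)%E) ->
  (exists C, forall t, t0 - tau <= t <= t0 -> `|phi t| <= C) ->
  measurable_fun `[t0 - tau, t0] phi ->
  0 < lam -> 0 < alpha ->
  let a_ k t := expR (lam * (t - h k t)) * b k t in
  let a t := \sum_(k < m) a_ k t - lam in
  (forall t, t0 <= t -> alpha <= a t) ->
  let M1 := (lam + \sum_(k < m) expR (lam * tau_ k) * rnorm (b k) `[t0%R, +oo[)
            * \sum_(k < m) tau_ k * rnorm (fun t => a_ k t / a t) `[t0%R, +oo[ in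
  M1 < 1 ->
  let M0 := (1 - M1)^-1 in
  is_solution b h f phi t0 tau x ->
  forall t, t0 <= t ->
    `|x t| <= M0 * expR (- lam * (t - t0)) *
                (`|x t0| + \sum_(k < m) (expR (lam * tau_ k) - 1) / lam
                              * rnorm (b k) `[t0%R, +oo[
                              * sup_norm phi `[t0 - tau, t0])
              + M0 / lam * rnorm f `[t0, t].
Proof.
move=> t0_ge0 m0 mb bfin mh hdelta hb tau mf ffin [C phiC] mphi lam0 alpha0 a_ a aalpha.
move=> M1 M11 M0 [xphi acx sol] T t0T.
pose B k := rnorm (b k) `[t0, +oo[.
pose Fn := rnorm f `[t0, T].
pose Phi := sup_norm phi `[t0 - tau, t0].
pose A k := expR (lam * tau_ k) * B k.
pose rho k := rnorm (fun t => a_ k t / a t) `[t0, +oo[.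
have tau0 k : 0 <= tau_ k by have /andP[h1 h2] := hdelta k; exact: le_trans h2.
have tau_le k : tau_ k <= tau by apply: le_bigmax.
have tau_ge0 : 0 <= tau by apply: bigmax_ge_id.
have B0 k : 0 <= B k := rnorm_ge0 _ _.
have rho0 k : 0 <= rho k := rnorm_ge0 _ _.
have Fn0 : 0 <= Fn := rnorm_ge0 _ _.
have A0 k : 0 <= A k by rewrite mulr_ge0// expR_ge0.
have ht k t : t0 <= t -> h k t <= t.
  move=> /(hb k)/andP[h1 _]; have /andP[h2 _] := hdelta k.
  by rewrite -subr_ge0 (le_trans h2).
have htau k t : t0 <= t -> t - h k t <= tau_ k by move=> /(hb k)/andP[].
have sub : `[t0, +oo[ `<=` `[0, +oo[.
  by move=> t /=; rewrite !in_itv/= !andbT; exact: le_trans.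
have mI0 : measurable (`[0, +oo[ : set (lebR R)) by exact: borel_leb_measurable.
have mS g : leb_measurable_on `[0, +oo[ g -> leb_measurable_on `[t0, +oo[ g.
  by move=> mg; apply: measurable_funS mg.
have mh0 k : leb_measurable_on `[t0, +oo[ (h k) by exact: mS.
have mw k : leb_measurable_on `[t0, +oo[ (fun t => lam * (t - h k t)).
  apply: measurable_funM; first exact: measurable_cst.
  apply: measurable_funB; last exact: mh0.
  by apply: borel_leb_measurable_fun; [exact: measurable_id|exact: measurable_itv].
have ma k : leb_measurable_on `[t0, +oo[ (weighted_coef b h lam k).
  exact: measurable_funM (leb_measurable_comp (@measurable_expR R) (mw k)) (mS _ (mb k)).
have bB : {ae @lebesgue_measure R, forall t, t0 < t -> forall k, `|b k t| <= B k}.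
  have H : forall k, {ae @lebesgue_measure R, forall t, `[t0, +oo[%classic t -> `|b k t| <= B k}.
    move=> k.
    apply: ae_le_rnorm; apply: (@ess_norm_lty _ _ _ (rnorm (b k) `[0, +oo[)).
    by apply: filterS (ae_le_rnorm (bfin k)) => t h1 /sub.
  apply: filterS (filter_forall _ H) => t h1 t0t k; apply: h1.
  by rewrite /= in_itv/= andbT ltW.
have fF : {ae @lebesgue_measure R, forall t, t0 < t < T -> `|f t| <= Fn}.
  apply: filterS (ae_le_rnorm (ffin T t0T)) => t h1 /andP[t0t tT]; apply: h1.
  by rewrite /= in_itv/= !ltW.
have phiPhi r : t0 - tau <= r <= t0 -> `|phi r| <= Phi.
  move=> rI; apply: ub_le_sup; last by exists r => //=; rewrite in_itv.
  by exists C => _ [s + <-]; rewrite /= in_itv/=; exact: phiC.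
have Phi0 : 0 <= Phi.
  by apply: le_trans (normr_ge0 (phi t0)) (phiPhi t0 _); rewrite lexx andbT gerBl.
have x_history k t : t0 <= t -> h k t < t0 -> `|x (h k t)| <= Phi.
  move=> t0t hk; have hI : t0 - tau <= h k t <= t0.
    by rewrite (ltW hk) andbT; have := htau k t t0t; have := tau_le k; lra.
  by rewrite xphi// phiPhi.
have dx : {ae @lebesgue_measure R, forall t, t0 < t ->
    is_derive t 1 x (f t - \sum_(k < m) b k t * x (h k t))}.
  apply: filterS sol => t h1 /ltW/h1[h2 h3]; apply/is_derive1P; split => //.
  by rewrite -h3 addrK.
have aA : {ae @lebesgue_measure R, forall t, t0 < t ->
    forall k, `|weighted_coef b h lam k t| <= A k}.
  apply: filterS bB => t h1 t0t k; rewrite normrM ger0_norm ?expR_ge0//.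
  rewrite ler_pM ?expR_ge0//; last exact: h1.
  by rewrite ler_expR ler_wpM2l ?(ltW lam0)// htau// ltW.
have a0 t : t0 <= t -> 0 < a t by move=> /aalpha; exact: lt_le_trans.
(* The quotients are essentially bounded by [A k / alpha], so [rho k] is a genuine bound. *)
have a_rho : {ae @lebesgue_measure R, forall t, t0 < t ->
    forall k, `|weighted_coef b h lam k t| <= rho k * a t}.
  have H : forall k, {ae @lebesgue_measure R, forall t, `[t0, +oo[%classic t ->
      `|a_ k t / a t| <= rho k}.
    move=> k.
    apply: ae_le_rnorm; apply: (@ess_norm_lty _ _ _ (A k / alpha)).
    apply: filterS2 aA (ae_neq t0) => t h1 tt0; rewrite /= in_itv/= andbT => t0t.
    have t0t' : t0 < t by rewrite lt_neqAle eq_sym tt0.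
    rewrite normrM normfV (gtr0_norm (a0 _ t0t)) ler_pM ?invr_ge0 ?(ltW (a0 _ t0t))//.
      exact: h1.
    by rewrite lef_pV2 ?posrE ?a0 ?aalpha.
  apply: filterS (filter_forall _ H) => t h1 t0t k.
  have at0 := a0 _ (ltW t0t).
  have := h1 k; rewrite normrM normfV (gtr0_norm at0) ler_pdivrMr//.
  by apply; rewrite /= in_itv/= andbT ltW.
(* At one time where the bounds hold, the sum of the [rho k * a t] dominates the sum of the
   [a_ k t], which is [a t + lam]. *)
have rho1 : 1 <= \sum_(k < m) rho k.
  have t01 : t0 < t0 + 1 by rewrite ltrDl.
  have [t /andP[t0t _] ht'] := ae_exists t01 a_rho.
  have at0 := a0 _ (ltW t0t).
  rewrite -(ler_pM2r at0) mul1r mulr_suml.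
  apply: (@le_trans _ _ (\sum_(k < m) a_ k t)); first by rewrite /a gerBl ltW.
  by apply: ler_sum => k _; apply: le_trans (ler_norm _) _; exact: ht'.
pose y := weighted_solution x lam t0.
pose V := source_majorant x lam t0 B tau_ Fn Phi.
pose L := lam + \sum_(k < m) A k.
have L0 : 0 <= L by rewrite addr_ge0 ?(ltW lam0)// sumr_ge0.
have key : `|y T| * (1 - M1) <= V T.
  have -> : M1 = L * \sum_(k < m) rho k * tau_ k.
    by rewrite /M1 /L; congr (_ * _); apply: eq_bigr => k _; rewrite mulrC.
  apply: (@le_of_perturbation _ _ (L * \sum_(k < m) rho k)) => //.
  - by rewrite mulr_ge0// sumr_ge0.
  - move: M11; rewrite /M1 /L; congr (_ * _ < _); apply: eq_bigr => k _.
    by rewrite mulrC.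
  (* Lengthening every delay by the step [e] raises the constant by [e * (L * \sum_k rho k)]. *)
  move=> e e0; have -> : L * \sum_(k < m) rho k * tau_ k + e * (L * \sum_(k < m) rho k) =
      L * \sum_(k < m) rho k * (tau_ k + e).
    under [in RHS]eq_bigr do rewrite mulrDr.
    by rewrite big_split/= -mulr_suml; ring.
  move=> Le.
  apply: (@superposition_bound R m (weighted_coef b h lam) h lam t0 T A tau_ rho
    (ltW lam0) t0T A0 tau0 rho0 ht htau aA ma mh0 _ a_rho rho1 y V _ _ _ _ _ _
    e _ e0 erefl Le).
  - by move=> t /a0/ltW.
  - exact: weighted_zero_before.
  - exact: (weighted_lipschitz lam0 t0T Phi0 ht bB fF x_history (acx T t0T) dx).
  - exact: source_majorant_lipschitz.
  - by move=> r t; exact: source_majorant_homo.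
  - exact: source_majorant_start.
  - exact: (weighted_equation lam0 B0 Phi0 htau bB fF x_history dx).
have q0 : 0 < 1 - M1 by rewrite subr_gt0.
set E := expR (lam * (T - t0)).
have E0 : 0 < E by exact: expR_gt0.
have yT : `|y T| = E * `|x T|.
  by rewrite /y /weighted_solution ltNge t0T/= normrM ger0_norm// ltW.
(* Extending each history term to its full duration [tau_ k] produces the factor
   [(expR (lam * tau_ k) - 1) / lam]. *)
have VT : V T <= Fn / lam * (E - 1) + (`|x t0| +
    \sum_(k < m) (expR (lam * tau_ k) - 1) / lam * B k * Phi).
  rewrite /V /source_majorant -/E.
  have : \sum_(k < m) B k * Phi / lam * expR (lam * (Num.min T (t0 + tau_ k) - t0)) <=
      \sum_(k < m) B k * Phi / lam * expR (lam * tau_ k).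
    apply: ler_sum => k _; rewrite ler_wpM2l ?divr_ge0 ?mulr_ge0 ?(ltW lam0)//.
    rewrite ler_expR ler_wpM2l ?(ltW lam0)// lerBlDl.
    by rewrite ge_min lexx orbT.
  have -> : \sum_(k < m) (expR (lam * tau_ k) - 1) / lam * B k * Phi =
      \sum_(k < m) B k * Phi / lam * expR (lam * tau_ k) - \sum_(k < m) B k * Phi / lam.
    by rewrite -sumrB; apply: eq_bigr => k _; field; rewrite gt_eqF.
  set S1 := \sum_(k < m) _; set S2 := \sum_(k < m) _; set S3 := \sum_(k < m) _.
  by rewrite mulrBr mulr1; lra.
set W := `|x t0| + _ in VT *.
have -> : expR (- lam * (T - t0)) = E^-1 by rewrite mulNr expRN.
rewrite /M0 -/Fn.
have -> : (1 - M1)^-1 * E^-1 * W + (1 - M1)^-1 / lam * Fn = (W + Fn / lam * E) / (E * (1 - M1)).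
  by field; rewrite !gt_eqF.
rewrite ler_pdivlMr ?mulr_gt0// mulrA [`|x T| * E]mulrC -yT.
(* Replacing [E - 1] by [E] in the forcing term gives the stated form. *)
apply: le_trans key _; apply: le_trans VT _.
have : 0 <= Fn / lam by rewrite divr_ge0// ltW.
by rewrite mulrBr mulr1; lra.
Qed.
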